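(* Let $V:\mathbb{R}\to\mathbb{R}$ be measurable, bounded below and such that $\liminf_{|x|\to\infty}\frac{V(x)}{x^2}>0$. Let $\mu_V$ be the unique minimizer of $E_V$ over the Borel probability measures on $\mathbb{R}$. Then there is a constant $C>0$ depending on $V$ such that for any probability measure $\mu$ on $\mathbb{R}$, $$C\,W_1^2(\mu,\mu_V)\le E_V(\mu\,|\,\mu_V).$$
   Context: For a Borel probability measure $\mu$ on $\mathbb{R}$, the logarithmic energy with external field $V$ is $$E_V(\mu)=\int V\,d\mu-\iint\log|x-y|\,\mu(dx)\mu(dy),$$ understood as $\iint\big[\tfrac12V(x)+\tfrac12V(y)-\log|x-y|\big]\mu(dx)\mu(dy)\in(-\infty,+\infty]$. The equilibrium measure $\mu_V$ is the unique probability measure minimizing $E_V$; its existence, uniqueness and compactness of support are taken as known for the potentials considered. The relative free entropy is $E_V(\mu|\mu_V)=E_V(\mu)-E_V(\mu_V)$. The Wasserstein distance is $W_1(\mu,\nu)=\inf_{\pi\in\Pi(\mu,\nu)}\int|x-y|\,\pi(dx\,dy)$, where $\Pi(\mu,\nu)$ is the set of probability measures on $\mathbb{R}^2$ with marginals $\mu,\nu$ (value $+\infty$ allowed). *)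

(* Defs.v *)
From HB Require Import structures.
From mathcomp Require Import all_boot all_order all_algebra.
From mathcomp Require Import all_classical all_reals all_analysis.

Set Implicit Arguments.
Unset Strict Implicit.
Unset Printing Implicit Defensive.

Import Order.TTheory GRing.Theory Num.Theory.
Import numFieldNormedType.Exports.

Local Open Scope classical_set_scope.
Local Open Scope ring_scope.
Local Open Scope ereal_scope.

(* The filter of the limit |x| -> oo on the line. *)
Definition abs_infty (R : realType) : set_system R :=
  filter_from [set: R] (fun r => [set x | (r < `|x|)%R]).

(* The kernel takes the value +oo on the diagonal, since lne 0 = -oo. *)
Definition log_energy (R : realType) (V : R -> R)
    (mu : probability (measurableTypeR R) R) : \bar R :=
  \int[mu \x mu]_z
    ((V z.1 / 2 + V z.2 / 2)%R%:E - lne `|z.1 - z.2|%R%:E).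

Definition equilibrium_measure (R : realType) (V : R -> R)
    (muV : probability (measurableTypeR R) R) : Prop :=
  let minimizer (mu : probability (measurableTypeR R) R) :=
    forall nu : probability (measurableTypeR R) R,
      log_energy V mu <= log_energy V nu in
  minimizer muV /\
  forall mu : probability (measurableTypeR R) R, minimizer mu ->
    forall A, measurable A -> mu A = muV A.

Definition relative_free_entropy (R : realType) (V : R -> R)
    (mu muV : probability (measurableTypeR R) R) : \bar R :=
  log_energy V mu - log_energy V muV.

Definition coupling (R : realType) (mu nu : probability (measurableTypeR R) R)
    (p : probability (measurableTypeR R * measurableTypeR R)%type R) : Prop :=
  forall A : set (measurableTypeR R), measurable A ->
    pushforward p fst A = mu A /\ pushforward p snd A = nu A.

Definition wasserstein1 (R : realType)
    (mu nu : probability (measurableTypeR R) R) : \bar R :=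
  ereal_inf [set \int[p]_z `|z.1 - z.2|%R%:E | p in coupling mu nu].

(* Main.v *)
Require Import Defs.
From HB Require Import structures.
From mathcomp Require Import all_boot all_order all_algebra.
From mathcomp Require Import all_classical all_reals all_analysis.
From mathcomp Require Import measurable_realfun ring lra.
Set Implicit Arguments.
Unset Strict Implicit.
Unset Printing Implicit Defensive.
Import Order.TTheory GRing.Theory Num.Theory.
Import numFieldNormedType.Exports.
Local Open Scope classical_set_scope.
Local Open Scope ring_scope.
Local Open Scope ereal_scope.

(** Let K(x,y) = V(x)/2 + V(y)/2 - log|x-y| + const and let I(mu,nu) be the
    integral of K against the product of mu and nu.  Quadratic growth of V lets
    the constant be chosen so that K(x,y) >= k (x^2 + y^2), which makes the
    energies integrals of nonnegative functions, and
    E_V(mu|nu) = I(mu,mu) - I(nu,nu) for nu the equilibrium measure.  Split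
      I(mu,mu) - I(nu,nu) = D + 2 L,
      D = I(mu,mu) + I(nu,nu) - 2 I(mu,nu),   L = I(mu,nu) - I(nu,nu).

    - The term D is the logarithmic energy of mu - nu.  Up to an error u/M,
      log M - log u - 1 is the integral over 0 < s < M of s^-2 (s - u)_+
      ([hat_superposition_ler], [hat_superposition_ger]), and the hat
      (s - |x-y|)_+ is the length of the set of all a such that the window
      ]a, a+s] contains both x and y ([hat_overlap]).  By Tonelli, D dominates
      the integral over s < M of s^-2 times the squared L^2 norm of
      a |-> mu ]a,a+s] - nu ]a,a+s], for every M ([energy_gap_ge]).  In the
      limit this is, up to a constant, the squared H^(1/2) seminorm of the
      difference of the distribution functions, reached without a Fourier
      transform.

    - The term L controls the tail of mu.  Testing minimality of nu against
      t mu|_A + (1 - t mu(A)) nu, for A = [-r,r] and t -> 0, gives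
      I(mu|_A, nu) >= mu(A) I(nu,nu) ([restricted_potential_ge]).  Off A the
      kernel is at least 2 I(nu,nu) once r is large, so L is at least k/2 times the
      integral of x^2 over the complement of A ([energy_tail]).  For mu = nu
      this says that nu is carried by A: the support of nu is compact.

    - The monotone coupling gives W_1(mu,nu) <= int |F_mu - F_nu|
      ([wasserstein1_le_distribution]).  For a in A and s >= 2 r the window
      ]a, a+s] leaves A on the right, so its two masses differ by
      F_nu(a) - F_mu(a) up to mu(~A); off A the integral of |F_mu - F_nu| is at
      most the integral of |y| against mu.

    Bounding each first power u by l u^2 + 1/l with a free l > 0, and averaging
    over s in [2r, 3r], turns this into W_1 <= l X + c/l with X at most a
    constant times D + 2 L ([wasserstein1_le_smoothed_gap]); optimizing over l
    yields the inequality. *)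

(** * The logarithm as a superposition of hat functions *)

Definition hat (R : realType) (s u : R) : R := Num.max 0%R (s - u)%R.

Definition hat_superposition (R : realType) (M u : R) : \bar R :=
  \int[lebesgue_measure]_(s in `[0%R, M]) (s ^- 2 * hat s u)%:E.

Arguments hat {R} (s u)%_ring_scope.
Arguments hat_superposition {R} (M u)%_ring_scope.

Lemma hat_ge0 (R : realType) (s u : R) : (0 <= hat s u)%R.
Proof. by rewrite /hat le_max lexx. Qed.

Lemma hat_mono (R : realType) (s u v : R) : (u <= v)%R -> (hat s v <= hat s u)%R.
Proof.
by move=> uv; rewrite /hat ge_max le_max lexx/= le_max lerD2l lerN2 uv orbT.
Qed.

Lemma hat_density_ge0 (R : realType) (s u : R) : (0 <= s ^- 2 * hat s u)%R.
Proof. by rewrite mulr_ge0 ?hat_ge0// invr_ge0 exprn_even_ge0. Qed.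

(** Inversion is not continuous at 0; writing s^-2 as exp (- log s^2) away from
    0 reduces measurability to that of exp and log. *)
Lemma measurable_invX2 (R : realType) (D : set (measurableTypeR R)) :
  measurable_fun D (fun s : measurableTypeR R => (s ^- 2)%R).
Proof.
apply: measurable_funTS.
have -> : (fun s : measurableTypeR R => (s ^- 2)%R) =
    (fun s : measurableTypeR R => if s == 0%R then 0%R else expR (- ln (s ^+ 2)%R)).
  apply/funext => s; case: eqP => [->|/eqP s0]; first by rewrite expr0n/= invr0.
  by rewrite expRN lnK// posrE exprn_even_gt0.
apply: measurable_fun_ifT => //; first exact: measurable_fun_eqr.
apply: measurableT_comp; first exact: measurable_expR.
apply: measurable_funN.
by apply: measurableT_comp; [exact: measurable_ln|exact: measurable_funX].
Qed.

Lemma measurable_hat_density (R : realType) (D : set (measurableTypeR R)) (u : R) :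
  measurable_fun D (fun s : measurableTypeR R => (s ^- 2 * hat s u)%R).
Proof.
apply: measurable_funM; first exact: measurable_invX2.
by apply: measurable_maxr => //; apply: measurable_funB.
Qed.

Lemma hat_superposition_ge0 (R : realType) (M u : R) : 0 <= hat_superposition M u.
Proof. by apply: integral_ge0 => s _; rewrite lee_fin hat_density_ge0. Qed.

Lemma hat_superposition_mono (R : realType) (M u v : R) :
  (u <= v)%R -> hat_superposition M v <= hat_superposition M u.
Proof.
move=> uv; apply: ge0_le_integral => //.
- by move=> s _; rewrite lee_fin hat_density_ge0.
- by apply/measurable_EFinP; apply: measurable_hat_density.
- by apply/measurable_EFinP; apply: measurable_hat_density.
- move=> s _; rewrite lee_fin ler_wpM2l ?hat_mono//.
  by rewrite invr_ge0 exprn_even_ge0.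
Qed.

Lemma hat_superposition_far (R : realType) (M u : R) :
  (M <= u)%R -> hat_superposition M u = 0.
Proof.
move=> Mu; apply: integral0_eq => s /=; rewrite in_itv/= => /andP[_ sM].
rewrite /hat; have /max_idPl -> : (s - u <= 0)%R by lra.
by rewrite mulr0.
Qed.

(** Below u the hat vanishes, and above u the integrand is s^-1 - u s^-2, with
    primitive log s + u/s. *)
Lemma hat_superposition_near (R : realType) (M u : R) : (0 < u)%R -> (u < M)%R ->
  hat_superposition M u = (ln M - ln u + u / M - 1)%:E.
Proof.
move=> u0 uM.
rewrite /hat_superposition.
have -> : `[0%R, M]%classic = `[0%R, u]%classic `|` `]u, M]%classic.
  by rewrite -itv_bndbnd_setU// bnd_simp ltW.
rewrite ge0_integral_setU//=; last 3 first.
- by apply/measurable_EFinP; apply: measurable_hat_density.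
- by move=> s _; rewrite lee_fin hat_density_ge0.
- apply/disj_setPS => s /= []; rewrite !in_itv/= => /andP[_ ?] /andP[? _]; lra.
rewrite integral0_eq ?add0e; last first.
  move=> s /=; rewrite in_itv/= => /andP[_ su].
  rewrite /hat; have /max_idPl -> : (s - u <= 0)%R by lra.
  by rewrite mulr0.
rewrite integral_itv_obnd_cbnd; last by apply/measurable_EFinP; apply: measurable_hat_density.
under eq_integral.
  move=> s; rewrite inE/= in_itv/= => /andP[us sM].
  have s0 : (0 < s)%R by lra.
  rewrite /hat; have /max_idPr -> : (0 <= s - u)%R by lra.
  rewrite (_ : _ * _ = s^-1 - u * s ^- 2)%R; last by field; lra.
  over.
have dF (s : R) : (0 < s)%R ->
    is_derive s 1%R (fun s : R => ln s + u * s^-1)%R (s^-1 - u * s ^- 2)%R.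
  move=> s0; have s0' := lt0r_neq0 s0.
  have dln := is_derive1_ln s0.
  have dinv := is_deriveV s0' (is_derive_id s 1%R).
  have := is_deriveD dln (is_deriveM (is_derive_cst u s 1%R) dinv).
  move=> /is_derive_eq; apply.
  rewrite /GRing.scale/= !mulr1 mulr0 addr0; congr (_ + _)%R.
  by rewrite mulrN.
rewrite (@continuous_FTC2 _ _ (fun s : R => ln s + u * s^-1)%R)//.
- rewrite -EFinB divff ?lt0r_neq0//; congr (_%:E).
  lra.
- apply: continuous_in_subspaceT => s; rewrite inE/= in_itv/= => /andP[us sM].
  have s0 : s != 0%R by rewrite gt_eqF//; lra.
  apply: continuousB; first exact: inv_continuous.
  apply: continuousM; first exact: cst_continuous.
  apply: (@continuous_comp _ _ _ (fun x : R => x ^+ 2)%R (fun x : R => x^-1)%R).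
    exact: exprn_continuous.
  by apply: inv_continuous; rewrite expf_neq0.
- split.
  + move=> s; rewrite in_itv/= => /andP[us _].
    by apply: (@ex_derive _ _ _ _ _ _ _ (dF _ _)); lra.
  + apply: cvg_at_right_filter.
    have /derivable1_diffP/differentiable_continuous :
        derivable (fun s : R => ln s + u * s^-1)%R u 1%R.
       by apply: (@ex_derive _ _ _ _ _ _ _ (dF _ _)); lra.
    exact.
  + apply: cvg_at_left_filter.
    have /derivable1_diffP/differentiable_continuous :
        derivable (fun s : R => ln s + u * s^-1)%R M 1%R.
       by apply: (@ex_derive _ _ _ _ _ _ _ (dF _ _)); lra.
    exact.
- move=> s; rewrite in_itv/= => /andP[us _].
  rewrite derive1E; apply: (@derive_val _ _ _ _ _ _ _ (dF _ _)); lra.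
Qed.

Lemma ln_le_subr1 (R : realType) (r : R) : (0 < r)%R -> (ln r <= r - 1)%R.
Proof.
move=> r0; have := @le_ln1Dx R (r - 1)%R; rewrite addrCA subrr addr0; apply; lra.
Qed.

(** There is equality for 0 < u < M by [hat_superposition_near]; for u >= M the
    superposition is 0 and the claim is log (u/M) <= u/M - 1. *)
Lemma hat_superposition_ler (R : realType) (M u : R) : (0 < M)%R -> (0 <= u)%R ->
  hat_superposition M u + 1 <= - lne u%:E + (ln M + u / M)%:E.
Proof.
move=> M0; rewrite le_eqVlt => /predU1P[<-|u0].
  by rewrite le0_lneNy//= leey.
rewrite lne_EFin// -EFinN -EFinD; have [uM|Mu] := ltP u M.
  rewrite hat_superposition_near// -EFinD lee_fin; lra.
rewrite hat_superposition_far// add0e lee_fin.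
have uM0 : (0 < u / M)%R by rewrite divr_gt0.
have := ln_le_subr1 uM0; rewrite ln_div ?posrE//; lra.
Qed.

(** For u = 0 the left side is +oo; the superposition is then +oo as well,
    because it dominates its values at all u > 0. *)
Lemma hat_superposition_ger (R : realType) (M u : R) : (0 < M)%R -> (0 <= u)%R ->
  - lne u%:E + (ln M)%:E <= hat_superposition M u + 1.
Proof.
move=> M0 u0.
have pos v : (0 < v)%R -> (- ln v + ln M)%:E <= hat_superposition M v + 1.
  move=> v0; have vM0 : (0 < v / M)%R by rewrite divr_gt0.
  have [vM|Mv] := ltP v M.
    rewrite hat_superposition_near// -EFinD lee_fin; lra.
  rewrite hat_superposition_far// add0e lee_fin.
  have : (0 <= ln (v / M))%R by rewrite ln_ge0// ler_pdivlMr// mul1r.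
  by rewrite ln_div ?posrE//; lra.
move: u0; rewrite le_eqVlt => /predU1P[<-|u0]; last first.
  by rewrite lne_EFin// -EFinN -EFinD pos.
suff -> : hat_superposition M 0 = +oo by rewrite addye// leey.
apply/eqyP => A A0.
(* this u makes log M - log u - 1 equal to A *)
have := pos (expR (ln M - A - 1)) (expR_gt0 _); rewrite expRK.
rewrite (_ : - _ + _ = A + 1)%R; last by lra.
rewrite EFinD leeD2rE// => /le_trans; apply.
by apply: hat_superposition_mono; exact: expR_ge0.
Qed.

(** * Distribution functions and the overlap of windows *)

Lemma measurable_boolset d (T : measurableType d) (b : T -> bool) :
  measurable_fun setT b -> measurable [set x | b x].
Proof.
move=> mb; rewrite (_ : [set x | b x] = setT `&` b @^-1` [set true]).
  exact: mb.
by rewrite setTI; apply/seteqP; split=> x.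
Qed.

(** Packaged as a probability, the product measure can in turn be a factor in
    Tonelli's theorem. *)
Definition product_probability d1 d2 (T1 : measurableType d1)
    (T2 : measurableType d2) (R : realType) (mu : probability T1 R)
    (nu : probability T2 R) : probability (T1 * T2)%type R :=
  (mu \x nu)%E.

Lemma tonelli_lebesgue d (T : measurableType d) (R : realType)
    (P : probability T R) (f : T * measurableTypeR R -> \bar R) :
  measurable_fun setT f -> (forall p, 0 <= f p) ->
  \int[P]_z \int[lebesgue_measure]_a f (z, a) =
  \int[lebesgue_measure]_a \int[P]_z f (z, a).
Proof. by move=> mf f0; exact: fubini_tonelli. Qed.

Section distribution_function.
Context (R : realType).
Notation T := (measurableTypeR R).
Implicit Types mu nu : probability T R.

(** Real valued, so that increments and their squares are real numbers. *)
Definition distribution_function mu (x : R) : R := fine (mu `]-oo, x]%classic).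

Arguments distribution_function mu x%_ring_scope.

Lemma distribution_functionE mu x :
  mu `]-oo, x]%classic = (distribution_function mu x)%:E.
Proof. by rewrite fineK// fin_num_measure. Qed.

Lemma distribution_function_nd mu :
  {homo distribution_function mu : x y / (x <= y)%R}.
Proof.
move=> x y xy; rewrite -lee_fin -!distribution_functionE le_measure ?inE//.
by apply: subset_itvl; rewrite bnd_simp.
Qed.

Lemma distribution_function_ge0 mu x : (0 <= distribution_function mu x)%R.
Proof. exact: fine_ge0. Qed.

Lemma distribution_function_le1 mu x : (distribution_function mu x <= 1)%R.
Proof. by rewrite -lee_fin -distribution_functionE probability_le1. Qed.

Lemma measurable_distribution_function mu :
  measurable_fun [set: T]
    (distribution_function mu : T -> T).
Proof.
by apply: nondecreasing_measurable => //; exact: distribution_function_nd.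
Qed.

Lemma measure_itv_oc mu (a b : R) : (a <= b)%R ->
  mu `]a, b]%classic = (distribution_function mu b - distribution_function mu a)%:E.
Proof.
move=> ab; rewrite EFinB -!distribution_functionE.
have -> : `]-oo, b]%classic = `]-oo, a]%classic `|` `]a, b]%classic :> set R.
  by rewrite -itv_bndbnd_setU// bnd_simp.
rewrite measureU//; last first.
  apply/seteqP; split=> // x /= []; rewrite !in_itv/= => xa /andP[ax _]; lra.
by rewrite addeAC subee ?add0e// fin_num_measure.
Qed.

(** The hat is the autocorrelation of the indicator of a window of length s:
    the admissible a form the interval [max x y - s, min x y[. *)
Lemma hat_overlap (s x y : R) :
  (hat s `|x - y|)%:E = \int[lebesgue_measure]_a
    (\1_`]a, (a + s)%R]%classic x * \1_`]a, (a + s)%R]%classic y)%:E.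
Proof.
wlog xy : x y / (x <= y)%R => [hwlog|].
  have [|yx] := leP x y; first exact: hwlog.
  rewrite distrC hwlog ?(ltW yx)//.
  by apply: eq_integral => a _; rewrite mulrC.
have -> : `|x - y|%R = (y - x)%R by rewrite distrC ger0_norm// subr_ge0.
transitivity (@lebesgue_measure R `[(y - s)%R, x[%classic).
  rewrite lebesgue_measure_itv/= lte_fin /hat.
  have [h|h] := ltP (y - s)%R x.
    by rewrite -EFinB; congr (_%:E); rewrite (max_idPr _); lra.
  by congr (_%:E); apply/max_idPl; lra.
rewrite -[in LHS](setIT `[_, _[%classic) -integral_indic//.
apply: eq_integral => a _; congr (_%:E).
rewrite !indicE -natrM mulnb; congr (nat_of_bool _)%:R.
apply/idP/andP; rewrite !inE/= !in_itv/=.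
  by move=> /andP[? ?]; split; apply/andP; split; lra.
by move=> [/andP[? ?] /andP[? ?]]; apply/andP; split; lra.
Qed.

(** Averaging [hat_overlap] over the product measure factors the two masses. *)
Lemma integral_hat mu nu (s : R) : (0 <= s)%R ->
  \int[mu \x nu]_z (hat s `|z.1 - z.2|)%:E =
  \int[lebesgue_measure]_a
    ((distribution_function mu (a + s) - distribution_function mu a) *
     (distribution_function nu (a + s) - distribution_function nu a))%:E.
Proof.
move=> s0.
pose b (p : (T * T) * T) :=
  ((p.2 < p.1.1) && (p.1.1 <= p.2 + s) && ((p.2 < p.1.2) && (p.1.2 <= p.2 + s)))%R.
have mb : measurable [set p | b p].
  apply: measurable_boolset; rewrite /b.
  have m2 : measurable_fun setT (fun p : (T * T) * T => p.2).
    exact: measurable_snd.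
  have m11 : measurable_fun setT (fun p : (T * T) * T => p.1.1).
    by apply: measurableT_comp.
  have m12 : measurable_fun setT (fun p : (T * T) * T => p.1.2).
    by apply: measurableT_comp.
  apply: measurable_and; apply: measurable_and.
  - exact: measurable_fun_ltr.
  - by apply: measurable_fun_ler => //; apply: measurable_funD.
  - exact: measurable_fun_ltr.
  - by apply: measurable_fun_ler => //; apply: measurable_funD.
have mf : measurable_fun setT
    (fun p : (T * T) * T => (\1_[set p | b p] p : R)%:E).
  by apply/measurable_EFinP; exact: measurable_indic.
have f0 (p : (T * T) * T) : 0 <= (\1_[set p | b p] p : R)%:E.
  by rewrite lee_fin.
have -> : (fun z : T * T => (hat s `|z.1 - z.2|)%:E) =
    (fun z => \int[lebesgue_measure]_a (\1_[set p | b p] (z, a))%:E).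
  apply/funext => z; rewrite hat_overlap; apply: eq_integral => a _.
  rewrite !indicE -natrM mulnb; congr (_%:R%:E); congr (nat_of_bool _).
  apply/andP/idP; rewrite !inE/= /b/= !in_itv/=.
    by move=> [-> ->].
  by move=> /andP.
rewrite (@tonelli_lebesgue _ _ _ (product_probability mu nu) _ mf f0)/=.
apply: eq_integral => a _.
rewrite EFinM -!measure_itv_oc ?lerDl// -product_measure1E//.
rewrite -[in RHS](setIT (_ `*` _)) -integral_indic//; last exact: measurableX.
apply: eq_integral => z _; rewrite !indicE; congr (_%:R%:E); congr (nat_of_bool _).
apply/idP/idP; rewrite !inE/= /b/= !in_itv/=.
  by move=> /andP.
by move=> [-> ->].
Qed.

End distribution_function.

Arguments distribution_function {R} mu x%_ring_scope.

(** * Polarization of the hat energies *)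

Section hat_decomposition.
Context (R : realType).
Notation T := (measurableTypeR R).
Implicit Types mu nu : probability T R.

(** The squared L^2 distance of the masses that mu and nu give to the window
    ]a, a+s], as a varies. *)
Definition increment_gap mu nu (s : R) : \bar R :=
  \int[lebesgue_measure]_a
    (((distribution_function mu (a + s) - distribution_function mu a) -
      (distribution_function nu (a + s) - distribution_function nu a)) ^+ 2)%:E.

Definition smoothed_gap mu nu (M : R) : \bar R :=
  \int[lebesgue_measure]_(s in `[0%R, M]) ((s ^- 2)%:E * increment_gap mu nu s).

Lemma increment_gap_ge0 mu nu s : 0 <= increment_gap mu nu s.
Proof. by apply: integral_ge0 => a _; rewrite lee_fin sqr_ge0. Qed.

Lemma invX2_ge0 (s : R) : 0 <= (s ^- 2)%:E.
Proof. by rewrite lee_fin invr_ge0 sqr_ge0. Qed.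

Lemma measurable_increment d (T : measurableType d) mu (f g : T -> R) :
  measurable_fun setT f -> measurable_fun setT g ->
  measurable_fun setT (fun t =>
    distribution_function mu (f t + g t)%R - distribution_function mu (f t))%R.
Proof.
move=> mf mg; apply: measurable_funB.
  apply: (measurableT_comp (measurable_distribution_function mu)).
  exact: measurable_funD.
exact: (measurableT_comp (measurable_distribution_function mu)).
Qed.

Lemma measurable_increment_gap mu nu (D : set T) :
  measurable_fun D (increment_gap mu nu).
Proof.
apply: measurable_funTS.
pose f (p : T * T) : \bar R :=
  (((distribution_function mu (p.2 + p.1) - distribution_function mu p.2) -
    (distribution_function nu (p.2 + p.1) - distribution_function nu p.2)) ^+ 2)%:E.
apply: (measurable_fun_fubini_tonelli_F (m2 := lebesgue_measure) f) => [|p].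
  apply/measurable_EFinP; apply: measurable_funX; apply: measurable_funB;
  exact: measurable_increment.
by rewrite lee_fin sqr_ge0.
Qed.

Lemma measurable_hat_dist (s : R) :
  measurable_fun setT (fun z : T * T =>
    hat s `|z.1 - z.2|%R).
Proof.
apply: measurable_maxr => //; apply: measurable_funB => //.
by apply: measurableT_comp => //; apply: measurable_funB.
Qed.

(** The identity p^2 + q^2 = 2 p q + (p - q)^2 for the masses p and q of a
    window, integrated.  The cross terms stand on the right so that no
    difference of possibly infinite quantities occurs. *)
Lemma integral_hatD mu nu (s : R) : (0 <= s)%R ->
  \int[mu \x mu]_z (hat s `|z.1 - z.2|%R)%:E +
  \int[nu \x nu]_z (hat s `|z.1 - z.2|%R)%:E =
  \int[mu \x nu]_z (hat s `|z.1 - z.2|%R)%:E +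
  \int[mu \x nu]_z (hat s `|z.1 - z.2|%R)%:E + increment_gap mu nu s.
Proof.
move=> s0; rewrite !integral_hat// /increment_gap.
pose inc (m : probability T R) (a : R) : R :=
  (distribution_function m (a + s) - distribution_function m a)%R.
have inc0 m a : (0 <= inc m a)%R.
  by rewrite subr_ge0 distribution_function_nd// lerDl.
have minc m : measurable_fun [set: T] (inc m).
  exact: measurable_increment.
have prod0 m n (a : T) : setT a -> 0 <= (inc m a * inc n a)%:E.
  by move=> _; rewrite lee_fin mulr_ge0.
have mprod m n : measurable_fun [set: T]
    (fun a => (inc m a * inc n a)%:E).
  by apply/measurable_EFinP; exact: measurable_funM.
rewrite -[LHS]ge0_integralD; [|exact: measurableT|exact: prod0|exact: mprod
  |exact: prod0|exact: mprod].
rewrite -[X in X + _]ge0_integralD; [|exact: measurableT|exact: prod0|exact: mprod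
  |exact: prod0|exact: mprod].
rewrite -ge0_integralD//.
- by apply: eq_integral => a _; rewrite -!EFinD; congr (_%:E); rewrite /inc; ring.
- by move=> a _; rewrite adde_ge0// (prod0 mu nu).
- by apply: emeasurable_funD; exact: mprod.
- by move=> a _; rewrite lee_fin sqr_ge0.
- by apply/measurable_EFinP; apply: measurable_funX; exact: (measurable_funB (minc mu) (minc nu)).
Qed.

Lemma measurable_integral_hat mu nu (D : set T) :
  measurable_fun D (fun s => \int[mu \x nu]_z (hat s `|z.1 - z.2|%R)%:E).
Proof.
apply: measurable_funTS.
pose f (p : T * (T * T)) : \bar R :=
  (hat p.1 `|p.2.1 - p.2.2|)%:E.
apply: (measurable_fun_fubini_tonelli_F (m2 := product_probability mu nu) f) => [|p].
  apply/measurable_EFinP; apply: measurable_maxr => //; apply: measurable_funB => //.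
  apply: (measurableT_comp (@normr_measurable R setT)).
  apply: measurable_funB.
    exact: (measurableT_comp measurable_fst measurable_snd).
  exact: (measurableT_comp measurable_snd measurable_snd).
by rewrite lee_fin hat_ge0.
Qed.

(** The integrand of [hat_superposition] extended by 0 to all s, as a function of
    the point and s together: Tonelli applies to this form. *)
Definition hat_density_joint (M : R)
    (p : (T * T) * T) : \bar R :=
  (\1_`[0%R, M]%classic p.2 * (p.2 ^- 2 * hat p.2 `|p.1.1 - p.1.2|%R))%:E.

Lemma hat_density_joint_ge0 M p : 0 <= hat_density_joint M p.
Proof. by rewrite lee_fin mulr_ge0// hat_density_ge0. Qed.

Lemma measurable_hat_density_joint M : measurable_fun setT (hat_density_joint M).
Proof.
apply/measurable_EFinP; apply: measurable_funM.
  by apply: (measurableT_comp (measurable_indic _)).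
apply: measurable_funM.
  have mi := @measurable_invX2 R setT.
  by apply: (measurableT_comp mi); exact: measurable_snd.
apply: measurable_maxr => //; apply: measurable_funB => //.
apply: (measurableT_comp (@normr_measurable R setT)).
apply: measurable_funB.
  exact: (measurableT_comp measurable_fst measurable_fst).
exact: (measurableT_comp measurable_snd measurable_fst).
Qed.

Lemma hat_superposition_joint M (z : T * T) :
  hat_superposition M `|z.1 - z.2|%R =
  \int[lebesgue_measure]_s hat_density_joint M (z, s).
Proof.
rewrite /hat_superposition integral_mkcond.
apply: eq_integral => s _.
by rewrite epatch_indic/= /hat_density_joint/= -EFinM mulrC.
Qed.

Lemma integral_hat_superposition mu nu (M : R) :
  \int[mu \x nu]_z hat_superposition M `|z.1 - z.2|%R =
  \int[lebesgue_measure]_(s in `[0%R, M])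
    ((s ^- 2)%:E * \int[mu \x nu]_z (hat s `|z.1 - z.2|%R)%:E).
Proof.
transitivity (\int[product_probability mu nu]_z
    \int[lebesgue_measure]_s hat_density_joint M (z, s)).
  by apply: eq_integral => z _; exact: hat_superposition_joint.
rewrite tonelli_lebesgue//; last 2 first.
- exact: measurable_hat_density_joint.
- exact: hat_density_joint_ge0.
rewrite [RHS]integral_mkcond.
apply: eq_integral => s _; rewrite epatch_indic/= /hat_density_joint/=.
under eq_integral do rewrite mulrA EFinM.
rewrite ge0_integralZl//; first by rewrite EFinM -muleA muleC.
- by apply/measurable_EFinP; exact: measurable_hat_dist.
- by move=> z _; rewrite lee_fin hat_ge0.
- by rewrite lee_fin mulr_ge0// invr_ge0 sqr_ge0.
Qed.

(** [integral_hatD] integrated against s^-2 over [0, M]. *)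
Lemma smoothed_gapE mu nu (M : R) :
  \int[mu \x mu]_z hat_superposition M `|z.1 - z.2|%R +
  \int[nu \x nu]_z hat_superposition M `|z.1 - z.2|%R =
  \int[mu \x nu]_z hat_superposition M `|z.1 - z.2|%R +
  \int[mu \x nu]_z hat_superposition M `|z.1 - z.2|%R + smoothed_gap mu nu M.
Proof.
rewrite !integral_hat_superposition /smoothed_gap.
have ih0 (m n : probability T R) s :
    0 <= \int[m \x n]_z (hat s `|z.1 - z.2|%R)%:E.
  by apply: integral_ge0 => z _; rewrite lee_fin hat_ge0.
pose J (m n : probability T R) (s : R) : \bar R :=
  (s ^- 2)%:E * \int[m \x n]_z (hat s `|z.1 - z.2|%R)%:E.
have J0 m n (s : T) : 0 <= J m n s.
  by rewrite mule_ge0// invX2_ge0.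
have mJ m n (D : set T) : measurable_fun D (J m n).
  apply: emeasurable_funM; last exact: measurable_integral_hat.
  by apply/measurable_EFinP; exact: measurable_invX2.
rewrite -[LHS]ge0_integralD//; last 4 first.
- by move=> s _; exact: J0.
- exact: mJ.
- by move=> s _; exact: J0.
- exact: mJ.
rewrite -[X in X + _]ge0_integralD//; last 4 first.
- by move=> s _; exact: J0.
- exact: mJ.
- by move=> s _; exact: J0.
- exact: mJ.
rewrite -ge0_integralD//; last 4 first.
- by move=> s _; apply: adde_ge0; exact: J0.
- by apply: emeasurable_funD; exact: mJ.
- by move=> s _; rewrite mule_ge0 ?invX2_ge0 ?increment_gap_ge0.
- apply: emeasurable_funM; last exact: measurable_increment_gap.
  by apply/measurable_EFinP; exact: measurable_invX2.
apply: eq_integral => s; rewrite inE/= in_itv/= => /andP[s0 _].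
rewrite /J -[LHS]ge0_muleDr; [|exact: ih0|exact: ih0].
rewrite integral_hatD// ge0_muleDr; last 2 first.
- by rewrite adde_ge0//; exact: ih0.
- exact: increment_gap_ge0.
by congr (_ + _); rewrite ge0_muleDr//; exact: ih0.
Qed.

End hat_decomposition.

(** * Positive definiteness of the logarithmic kernel *)

Section product_integrals.
Context (R : realType).
Implicit Types mu nu : probability (measurableTypeR R) R.
Notation T := (measurableTypeR R).

Lemma integral_fst mu nu (f : T -> \bar R) : measurable_fun setT f ->
  (forall x, 0 <= f x) -> \int[mu \x nu]_z f z.1 = \int[mu]_x f x.
Proof.
move=> mf f0; rewrite (@fubini_tonelli1 _ _ _ _ _ mu nu (fun z => f z.1))//.
  apply: eq_integral => x _; rewrite /fubini_F/= integral_cst//.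
  by rewrite [X in _ * X]probability_setT mule1.
exact: measurableT_comp.
Qed.

Lemma integral_snd mu nu (f : T -> \bar R) : measurable_fun setT f ->
  (forall x, 0 <= f x) -> \int[mu \x nu]_z f z.2 = \int[nu]_x f x.
Proof.
move=> mf f0; rewrite (@fubini_tonelli2 _ _ _ _ _ mu nu (fun z => f z.2))//.
  apply: eq_integral => x _; rewrite /fubini_G/= integral_cst//.
  by rewrite [X in _ * X]probability_setT mule1.
exact: measurableT_comp.
Qed.

Lemma integral_product_cst mu nu (r : \bar R) : \int[mu \x nu]__ r = r.
Proof.
rewrite integral_cst//; have := probability_setT (product_probability mu nu).
by rewrite /product_probability/= => ->; rewrite mule1.
Qed.

End product_integrals.

Section energy_gap.
Context (R : realType).
Notation T := (measurableTypeR R).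
Implicit Types mu nu : probability T R.

(** The potential enters only through b, which is V/2 plus a constant; the
    constant is chosen later so that the kernel is nonnegative. *)
Definition log_kernel (b : R -> R) (z : R * R) : \bar R :=
  (b z.1 + b z.2)%:E - lne `|z.1 - z.2|%R%:E.

Definition mutual_energy (b : R -> R) mu nu : \bar R :=
  \int[mu \x nu]_z log_kernel b z.

Lemma measurable_dist :
  measurable_fun setT (fun z : T * T => `|z.1 - z.2|%R : R).
Proof.
by apply: (measurableT_comp (@normr_measurable R setT)); apply: measurable_funB.
Qed.

Lemma measurable_sum_potential (b : R -> R) :
  measurable_fun [set: T] (b : T -> T) ->
  measurable_fun setT (fun z : T * T => b z.1 + b z.2)%R.
Proof.
move=> mb; apply: measurable_funD.
  exact: (measurableT_comp mb measurable_fst).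
exact: (measurableT_comp mb measurable_snd).
Qed.

Lemma measurable_log_kernel (b : R -> R) : measurable_fun [set: T] (b : T -> T) ->
  measurable_fun [set: T * T] (log_kernel b).
Proof.
move=> mb; apply: emeasurable_funB.
  by apply/measurable_EFinP; exact: measurable_sum_potential.
rewrite (_ : (fun z : T * T => lne `|z.1 - z.2|%R%:E) =
  (fun z : T * T => if (`|z.1 - z.2| <= 0)%R then -oo else (ln `|z.1 - z.2|%R)%:E)).
  apply: measurable_fun_ifT => //; first exact: (measurable_fun_ler measurable_dist).
  apply/measurable_EFinP.
  exact: (measurableT_comp (@measurable_ln R) measurable_dist).
apply/funext => z; case: ifPn => [z0|]; first by rewrite le0_lneNy.
by rewrite -ltNge => z0; rewrite lne_EFin.
Qed.

Lemma measurable_hat_superposition (M : R) :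
  measurable_fun setT (fun z : T * T => hat_superposition M `|z.1 - z.2|%R).
Proof.
have f0 p := hat_density_joint_ge0 M p.
have mf := measurable_hat_density_joint M.
rewrite (_ : (fun z => _) =
    fubini_F lebesgue_measure (hat_density_joint M)); last first.
  by apply/funext => z; rewrite /fubini_F hat_superposition_joint.
exact: measurable_fun_fubini_tonelli_F.
Qed.

Lemma smoothed_gap_mono mu nu (M N : R) : (M <= N)%R ->
  smoothed_gap mu nu M <= smoothed_gap mu nu N.
Proof.
move=> MN; apply: ge0_subset_integral => //.
- apply: emeasurable_funM; last exact: measurable_increment_gap.
  by apply/measurable_EFinP; exact: measurable_invX2.
- by move=> s _; rewrite mule_ge0 ?invX2_ge0 ?increment_gap_ge0.
- by apply: subset_itvl; rewrite bnd_simp.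
Qed.

Lemma smoothed_gap_ge0 mu nu (M : R) : 0 <= smoothed_gap mu nu M.
Proof.
by apply: integral_ge0 => s _; rewrite mule_ge0 ?invX2_ge0 ?increment_gap_ge0.
Qed.

Lemma lee_cancel_shift2 (a s : \bar R) (l x : R) : 0 <= a -> 0 <= s ->
  (a + l%:E) + (a + l%:E) + s <= (x + l + l)%:E -> a + a + s <= x%:E.
Proof.
case: a => [a| |]//; case: s => [s| |]// _ _.
by rewrite -!EFinD !lee_fin; lra.
Qed.

Lemma exchange_polarized_sums (u v w s p q : \bar R) : u + v = w + w + s ->
  (w + (1 + (p + q))) + (w + (1 + (p + q))) + s =
  (u + (1 + (p + p))) + (v + (1 + (q + q))).
Proof.
move=> uvws; rewrite [X in X + s]addeACA [LHS]addeAC -uvws [RHS]addeACA; congr (_ + _).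
by rewrite [LHS]addeACA [RHS]addeACA; congr (_ + _); rewrite addeACA.
Qed.

(** Replacing - log |x-y| by the superposition of hats truncated at M costs a
    constant log M - 1, the same for the four energies involved, and an error
    |x-y|/M in the two diagonal terms.  What remains is [smoothed_gapE].  The
    diagonal energies are finite and dominate the mean distances, so the error
    vanishes as M grows. *)
Lemma energy_gap_ge (b : R -> R) (c : R) mu nu (M0 : R) :
  measurable_fun [set: T] (b : T -> T) -> (forall x, 0 <= b x)%R ->
  (forall z, 0 <= log_kernel b z) -> (0 <= c)%R ->
  (forall z, `|z.1 - z.2|%R%:E <= 1 + c%:E * log_kernel b z) ->
  mutual_energy b mu mu < +oo -> mutual_energy b nu nu < +oo ->
  mutual_energy b mu nu + mutual_energy b mu nu + smoothed_gap mu nu M0 <=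
  mutual_energy b mu mu + mutual_energy b nu nu.
Proof.
move=> mb b0 K0 c0 Kdist Imu Inu.
have mK := measurable_log_kernel mb.
have I0 (m n : probability T R) : 0 <= mutual_energy b m n by apply: integral_ge0 => z _.
pose H (m n : probability T R) := \int[m \x n]_z (`|z.1 - z.2|%R)%:E.
have H0 (m n : probability T R) : 0 <= H m n by apply: integral_ge0 => z _; rewrite lee_fin.
have HI m n : H m n <= 1 + c%:E * mutual_energy b m n.
  rewrite -(integral_product_cst m n 1) -ge0_integralZl// -ge0_integralD//; last 2 first.
  - by move=> z _; rewrite mule_ge0.
  - by apply: measurable_funeM.
  apply: ge0_le_integral => //.
  - by apply/measurable_EFinP; exact: measurable_dist.
  - by apply: emeasurable_funD => //; apply: measurable_funeM.
have Hfin m : mutual_energy b m m < +oo -> H m m \is a fin_num.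
  move=> Im; rewrite ge0_fin_numE//; apply: le_lt_trans (HI m m) _.
  by rewrite lte_add_pinfty// ?ltry// lte_mul_pinfty.
have Ifin m : mutual_energy b m m < +oo -> mutual_energy b m m \is a fin_num.
  by move=> Im; rewrite ge0_fin_numE.
pose B (m : probability T R) := \int[m]_x (b x)%:E.
have B0 m : 0 <= B m by apply: integral_ge0 => x _; rewrite lee_fin.
have mbE : measurable_fun [set: T] (fun x => (b x)%:E) by exact/measurable_EFinP.
have bE0 x : 0 <= (b x)%:E by rewrite lee_fin.
(* the claim up to an error of order 1/M; M >= 1 keeps log M nonnegative *)
have key M : (1 <= M)%R -> (M0 <= M)%R ->
    mutual_energy b mu nu + mutual_energy b mu nu + smoothed_gap mu nu M0 <=
    (fine (mutual_energy b mu mu) + fine (mutual_energy b nu nu) +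
     (fine (H mu mu) + fine (H nu nu)) / M)%:E.
  move=> M1 M0M.
  have Mgt0 : (0 < M)%R by lra.
  have l0 : (0 <= ln M)%R by exact: ln_ge0.
  pose U (m n : probability T R) := \int[m \x n]_z hat_superposition M `|z.1 - z.2|%R.
  have U0 m n : 0 <= U m n by apply: integral_ge0 => z _; exact: hat_superposition_ge0.
  have mU := measurable_hat_superposition M.
  have hs0 (z : T * T) : 0 <= hat_superposition M `|z.1 - z.2|%R by exact: hat_superposition_ge0.
  have ms := measurable_sum_potential mb.
  have sE (m n : probability T R) : \int[m \x n]_z
      (hat_superposition M `|z.1 - z.2|%R + (1 + (b z.1 + b z.2))%:E) =
      U m n + (1 + (B m + B n)).
    rewrite ge0_integralD//; last 2 first.
    - by move=> z _; rewrite lee_fin !addr_ge0.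
    - by apply/measurable_EFinP; apply: measurable_funD.
    congr (_ + _).
    under eq_integral do rewrite EFinD EFinD.
    rewrite ge0_integralD//; last 2 first.
    - by move=> z _; rewrite adde_ge0.
    - by apply/measurable_EFinP.
    rewrite [X in X + _]integral_product_cst; congr (_ + _).
    rewrite ge0_integralD//.
    - rewrite (@integral_fst _ m n (fun x => (b x)%:E))//.
      by rewrite (@integral_snd _ m n (fun x => (b x)%:E)).
    - exact: (measurableT_comp mbE measurable_fst).
    - exact: (measurableT_comp mbE measurable_snd).
  have upper m n : mutual_energy b m n + (ln M)%:E <= U m n + (1 + (B m + B n)).
    rewrite -sE -[X in _ + X <= _](integral_product_cst m n) -ge0_integralD//.
    apply: ge0_le_integral => //.
    - by move=> z _; rewrite adde_ge0// lee_fin.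
    - exact: emeasurable_funD.
    - by apply: emeasurable_funD => //; apply/measurable_EFinP; apply: measurable_funD.
    - move=> z _; rewrite (EFinD 1) addeA [leRHS]addeC /log_kernel -addeA.
      by apply: leeD2l; exact: hat_superposition_ger.
  have lower m : U m m + (1 + (B m + B m)) <=
      mutual_energy b m m + (ln M)%:E + (M^-1)%:E * H m m.
    rewrite -sE -[X in _ + X + _](integral_product_cst m m) -ge0_integralD//.
    rewrite -ge0_integralZl//; last 2 first.
    - by apply/measurable_EFinP; exact: measurable_dist.
    - by rewrite lee_fin invr_ge0 ltW.
    rewrite -ge0_integralD//; last 4 first.
    - by move=> z _; rewrite adde_ge0// lee_fin.
    - exact: emeasurable_funD.
    - by move=> z _; rewrite mule_ge0// lee_fin// invr_ge0 ltW.
    - by apply: measurable_funeM; apply/measurable_EFinP; exact: measurable_dist.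
    apply: ge0_le_integral => //.
    - by move=> z _; rewrite adde_ge0// lee_fin !addr_ge0.
    - by apply: emeasurable_funD => //; apply/measurable_EFinP; apply: measurable_funD.
    - apply: emeasurable_funD; first exact: emeasurable_funD.
      by apply: measurable_funeM; apply/measurable_EFinP; exact: measurable_dist.
    - move=> z _; rewrite (EFinD 1) addeA [leLHS]addeC /log_kernel -[leRHS]addeA -[leRHS]addeA.
      by apply: leeD2l; rewrite -EFinM -EFinD (mulrC M^-1%R); exact: hat_superposition_ler.
  have SM := smoothed_gap_mono mu nu M0M.
  apply: (@lee_cancel_shift2 _ _ (ln M)) => //; first exact: smoothed_gap_ge0.
  apply: le_trans (_ : _ <= U mu mu + (1 + (B mu + B mu)) +
      (U nu nu + (1 + (B nu + B nu)))) _.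
    apply: le_trans (_ : _ <= (U mu nu + (1 + (B mu + B nu))) +
        (U mu nu + (1 + (B mu + B nu))) + smoothed_gap mu nu M) _.
      by apply: leeD => //; apply: leeD; exact: upper.
    by rewrite (exchange_polarized_sums _ _ (smoothed_gapE mu nu M)).
  apply: le_trans (leeD (lower mu) (lower nu)) _.
  rewrite -(fineK (Ifin _ Imu)) -(fineK (Ifin _ Inu)).
  rewrite -(fineK (Hfin _ Imu)) -(fineK (Hfin _ Inu)).
  by rewrite -!EFinM -!EFinD lee_fin; lra.
rewrite -(fineK (Ifin _ Imu)) -(fineK (Ifin _ Inu)) -EFinD.
apply/lee_addgt0Pr => e e0.
pose h := (fine (H mu mu) + fine (H nu nu))%R.
have h0 : (0 <= h)%R by rewrite addr_ge0 ?fine_ge0.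
pose M := (1 + `|M0| + h / e)%R.
have he0 : (0 <= h / e)%R by rewrite divr_ge0// ltW.
have M0abs := ler_norm M0; have abs0 := normr_ge0 M0.
apply: le_trans (key M _ _) _; [rewrite /M; lra|rewrite /M; lra|].
rewrite -EFinD lee_fin lerD2l -/h.
have Mgt0 : (0 < M)%R by rewrite /M; lra.
rewrite ler_pdivrMr// mulrC -ler_pdivrMr//; rewrite /M; lra.
Qed.

End energy_gap.

(** * Perturbation of the minimizer and decay of tails *)

Lemma ge0_integral_mrestr d (T : measurableType d) (R : realType)
    (mu : {measure set T -> \bar R}) (A : set T) (mA : measurable A)
    (f : T -> \bar R) : measurable_fun setT f -> (forall x, 0 <= f x) ->
  \int[mrestr mu mA]_x f x = \int[mu]_(x in A) f x.
Proof.
move=> mf f0; rewrite (@ge0_negligible_integral _ _ _ _ setT (~` A))//.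
- rewrite setTD setCK; apply: eq_measure_integral => B mB BA.
  by transitivity (mu (B `&` A)) => //; rewrite setIidl.
- exact: measurableC.
- by transitivity (mu (~` A `&` A)) => //; rewrite setICl measure0.
Qed.

Lemma ge0_integral_lincomb d (T : measurableType d) (R : realType)
    (mu : {measure set T -> \bar R}) (D : set T) (f g : T -> \bar R) (s w : R) :
  measurable D -> measurable_fun D f -> measurable_fun D g ->
  (forall x, 0 <= f x) -> (forall x, 0 <= g x) -> (0 <= s)%R -> (0 <= w)%R ->
  \int[mu]_(x in D) (s%:E * f x + w%:E * g x) =
  s%:E * \int[mu]_(x in D) f x + w%:E * \int[mu]_(x in D) g x.
Proof.
move=> mD mf mg f0 g0 s0 w0; rewrite ge0_integralD//.
- by rewrite !ge0_integralZl// => x _.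
- by move=> x _; rewrite mule_ge0.
- exact: measurable_funeM.
- by move=> x _; rewrite mule_ge0.
- exact: measurable_funeM.
Qed.

Section mixture.
Context (R : realType).
Notation T := (measurableTypeR R).
Variables (mu nu : probability T R) (A : set T) (mA : measurable A).
Variables (t : {nonneg R}) (t1 : (t%:num <= 1)%R).

Lemma mixture_weight_ge0 : (0 <= 1 - t%:num * fine (mu A))%R.
Proof.
have mA1 : (fine (mu A) <= 1)%R.
  by rewrite -lee_fin fineK ?fin_num_measure// probability_le1.
by rewrite subr_ge0 mulr_ile1// fine_ge0.
Qed.

Definition mixture_weight : {nonneg R} := NngNum mixture_weight_ge0.

(** The competitor t mu|_A + (1 - t mu(A)) nu: moving the mass of mu off A onto nu
    makes it a probability without dividing by mu(A), which may vanish. *)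
Definition mixture : set T -> \bar R :=
  measure_add (mscale t (mrestr mu mA)) (mscale mixture_weight nu).

HB.instance Definition _ := Measure.on mixture.

Let mixture_setT : mixture setT = 1.
Proof.
rewrite /mixture measure_addE.
transitivity (t%:num%:E * mu (setT `&` A) +
    (1 - t%:num * fine (mu A))%:E * nu setT) => //.
rewrite setTI [nu setT]probability_setT mule1 -{1}[mu A]fineK ?fin_num_measure// -EFinM -EFinD.
by congr (_%:E); lra.
Qed.

HB.instance Definition _ := Measure_isProbability.Build _ _ _ mixture mixture_setT.

Lemma integral_mixture (f : T -> \bar R) : measurable_fun setT f ->
  (forall x, 0 <= f x) ->
  \int[mixture]_x f x = t%:num%:E * \int[mu]_(x in A) f x +
    (1 - t%:num * fine (mu A))%:E * \int[nu]_x f x.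
Proof.
move=> mf f0; rewrite ge0_integral_measure_add//; congr (_ + _).
  rewrite ge0_integral_mscale//.
  rewrite [X in _ * X = _]ge0_integral_mrestr//.
by rewrite ge0_integral_mscale.
Qed.

Definition mixture_probability : probability T R := mixture.

End mixture.

Section confinement.
Context (R : realType).
Notation T := (measurableTypeR R).
Implicit Types mu nu : probability T R.

Lemma log_kernel_sym (b : R -> R) x y : log_kernel b (x, y) = log_kernel b (y, x).
Proof. by rewrite /log_kernel/= (addrC (b x)) distrC. Qed.

Definition potential (b : R -> R) nu (x : T) : \bar R :=
  \int[nu]_y log_kernel b (x, y).

Lemma measurable_potential (b : R -> R) nu (D : set T) :
  measurable_fun [set: T] (b : T -> T) -> (forall z, 0 <= log_kernel b z) ->
  measurable_fun D (potential b nu).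
Proof.
move=> mb K0; apply: measurable_funTS.
apply: (measurable_fun_fubini_tonelli_F (m2 := nu) (log_kernel b)) => //.
exact: measurable_log_kernel.
Qed.

Lemma potential_ge0 (b : R -> R) nu x :
  (forall z, 0 <= log_kernel b z) -> 0 <= potential b nu x.
Proof. by move=> K0; apply: integral_ge0 => y _. Qed.

Lemma mutual_energyE (b : R -> R) mu nu :
  measurable_fun [set: T] (b : T -> T) -> (forall z, 0 <= log_kernel b z) ->
  mutual_energy b mu nu = \int[mu]_x potential b nu x.
Proof.
move=> mb K0; exact: (@fubini_tonelli1 _ _ _ _ _ mu nu (log_kernel b)
  (measurable_log_kernel mb) K0).
Qed.

(** The right side is g + 2 t (be - m g) + O(t^2), so minimality at t = 0 forces
    the linear coefficient to be nonnegative. *)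
Lemma le_of_quadratic_perturbation (a be g m : R) :
  (0 <= a)%R -> (0 <= be)%R -> (0 <= g)%R -> (0 <= m)%R ->
  (forall t, 0 <= t -> t <= 1 ->
    g <= t * (t * a + (1 - t * m) * be) + (1 - t * m) * (t * be + (1 - t * m) * g))%R ->
  (m * g <= be)%R.
Proof.
move=> a0 be0 g0 m0 h; rewrite leNgt; apply/negP => bem.
pose d := (m * g - be)%R; pose S := (a + m ^+ 2 * g + d + 1)%R.
have d0 : (0 < d)%R by rewrite /d; lra.
have mg0 : (0 <= m ^+ 2 * g)%R by rewrite mulr_ge0// sqr_ge0.
have mb0 : (0 <= m * be)%R by rewrite mulr_ge0.
have S0 : (0 < S)%R by rewrite /S; lra.
pose t := (d / S)%R.
have t0 : (0 < t)%R by rewrite divr_gt0.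
have tS : (t * S = d)%R by rewrite /t divfK// gt_eqF.
have t1 : (t <= 1)%R by rewrite ler_pdivrMr// mul1r /S; lra.
have := h t (ltW t0) t1.
have -> : (t * (t * a + (1 - t * m) * be) + (1 - t * m) * (t * be + (1 - t * m) * g)
   = g + t * (t * (a + m ^+ 2 * g - 2 * (m * be)) - 2 * d))%R.
  by rewrite /d; ring.
rewrite -lerBlDl subrr pmulr_rge0// => h1.
have : (t * (a + m ^+ 2 * g - 2 * (m * be)) <= t * S)%R.
  by rewrite ler_pM2l// /S; lra.
rewrite tS; lra.
Qed.

(** First-order condition at the minimizer nu in the direction of mu restricted
    to A.  The energy of [mixture] is quadratic in t, with coefficients the
    energies of mu|_A and nu; by symmetry of the kernel the two mixed ones
    agree. *)
Lemma restricted_potential_ge (b : R -> R) mu nu (A : set T) : measurable A ->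
  measurable_fun [set: T] (b : T -> T) -> (forall z, 0 <= log_kernel b z) ->
  (forall rho : probability T R,
    mutual_energy b nu nu <= mutual_energy b rho rho) ->
  mutual_energy b nu nu < +oo -> mutual_energy b mu mu < +oo ->
  mu A * mutual_energy b nu nu <= \int[mu]_(x in A) potential b nu x.
Proof.
move=> mA mb K0 minnu Inu Imu.
have mK := measurable_log_kernel mb.
have I0 (m n : probability T R) : 0 <= mutual_energy b m n by apply: integral_ge0 => z _.
have P0 (n : probability T R) x : 0 <= potential b n x by exact: potential_ge0.
have mP (n : probability T R) (D : set T) : measurable_fun D (potential b n).
  exact: measurable_potential.
pose al := \int[mu]_(x in A) \int[mu]_(y in A) log_kernel b (x, y).
pose be := \int[mu]_(x in A) potential b nu x.
rewrite -/be.
have [->|beoo] := eqVneq be +oo; first by rewrite leey.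
have be0 : 0 <= be by apply: integral_ge0 => x _.
have bef : be \is a fin_num by rewrite ge0_fin_numE// ltey.
have msec (x : T) (D : set T) : measurable_fun D (fun y : T => log_kernel b (x, y)).
  apply: measurable_funTS.
  by apply: (measurableT_comp mK); exact: measurable_pair1.
have mKA : measurable_fun [set: T] (fun x => \int[mu]_(y in A) log_kernel b (x, y)).
  rewrite (_ : (fun x => _) = fubini_F (mrestr mu mA) (log_kernel b)); last first.
    apply/funext => x; rewrite /fubini_F ge0_integral_mrestr//.
  exact: measurable_fun_fubini_tonelli_F.
have KA0 x : 0 <= \int[mu]_(y in A) log_kernel b (x, y) by apply: integral_ge0 => y _.
have alI : al <= mutual_energy b mu mu.
  rewrite mutual_energyE//.
  apply: le_trans (_ : \int[mu]_(x in A) potential b mu x <= _); last first.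
    exact: ge0_subset_integral.
  apply: ge0_le_integral => //.
  - exact: measurable_funTS.
  - by move=> x _; apply: ge0_subset_integral.
have al0 : 0 <= al by apply: integral_ge0 => x _.
have alf : al \is a fin_num.
  by rewrite ge0_fin_numE//; exact: le_lt_trans alI Imu.
have Inuf : mutual_energy b nu nu \is a fin_num by rewrite ge0_fin_numE.
have crossE : \int[nu]_x \int[mu]_(y in A) log_kernel b (x, y) = be.
  rewrite /be; under eq_integral do rewrite -(ge0_integral_mrestr mu mA)//.
  pose muA : {sigma_finite_measure set T -> \bar R} := mrestr mu mA.
  rewrite (@fubini_tonelli _ _ _ _ _ nu muA (log_kernel b))//.
  rewrite [LHS]ge0_integral_mrestr//.
  - apply: eq_integral => y _; apply: eq_integral => x _; exact: log_kernel_sym.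
  - exact: (measurable_fun_fubini_tonelli_G (m1 := nu) (log_kernel b)).
  - by move=> x; exact: integral_ge0.
have mAf : mu A \is a fin_num by exact: fin_num_measure.
rewrite -(fineK mAf) -(fineK Inuf) -(fineK bef) -EFinM lee_fin.
apply: (@le_of_quadratic_perturbation (fine al)); rewrite ?fine_ge0// => t t0 t1.
have t1' : ((NngNum t0)%:num <= 1)%R by [].
have := minnu (mixture_probability mu nu mA t1').
rewrite [leRHS]mutual_energyE// [leRHS]integral_mixture//.
have potE x : potential b (mixture_probability mu nu mA t1') x =
    t%:E * \int[mu]_(y in A) log_kernel b (x, y) + (1 - t * fine (mu A))%:E * potential b nu x.
  by rewrite /potential integral_mixture.
have w0 := mixture_weight_ge0 mu mA t1'.
under eq_integral do rewrite potE.
under [X in _ + _ * X]eq_integral do rewrite potE.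
rewrite !ge0_integral_lincomb//; last exact: measurable_funTS.
rewrite -/al -/be crossE -mutual_energyE//.
rewrite -(fineK Inuf) -(fineK bef) -(fineK alf).
by rewrite -!EFinM -!EFinD lee_fin.
Qed.

(** On [-r, r] the potential of nu is bounded below on average by
    [restricted_potential_ge]; off [-r, r] it is at least k x^2, half of which
    pays for the energy of nu by the choice of r. *)
Lemma energy_tail (b : R -> R) (k r : R) mu nu :
  measurable_fun [set: T] (b : T -> T) ->
  (forall z, (k * z.1 ^+ 2)%:E <= log_kernel b z) -> (0 < k)%R ->
  (forall rho : probability T R,
    mutual_energy b nu nu <= mutual_energy b rho rho) ->
  mutual_energy b mu mu < +oo -> (0 <= r)%R ->
  mutual_energy b nu nu + mutual_energy b nu nu <= (k * r ^+ 2)%:E ->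
  mutual_energy b nu nu +
    (k / 2)%:E * \int[mu]_(x in ~` `[(- r)%R, r]) (x ^+ 2)%:E <=
  mutual_energy b mu nu.
Proof.
move=> mb Kk k0 minnu Imu r0 kr.
have K0 z : 0 <= log_kernel b z.
  by apply: le_trans (Kk z); rewrite lee_fin mulr_ge0 ?sqr_ge0// ltW.
have I0 (m n : probability T R) : 0 <= mutual_energy b m n by apply: integral_ge0 => z _.
have Inu : mutual_energy b nu nu < +oo by exact: le_lt_trans (minnu mu) Imu.
have mP (n : probability T R) (D : set T) : measurable_fun D (potential b n).
  exact: measurable_potential.
have mA : measurable (`[(- r)%R, r]%classic : set T) by exact: measurable_itv.
have := restricted_potential_ge mA mb K0 minnu Inu Imu.
have Inuf : mutual_energy b nu nu \is a fin_num by rewrite ge0_fin_numE.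
move: kr; rewrite (mutual_energyE mu nu)// -(fineK Inuf) -EFinD lee_fin.
set g := fine _ => kr => hA.
have g0 : (0 <= g)%R by exact: fine_ge0.
set A := `[(- r)%R, r]%classic in mA hA *.
have mAC : measurable (~` A) by exact: measurableC.
have -> : \int[mu]_x potential b nu x = \int[mu]_(x in A) potential b nu x +
    \int[mu]_(x in ~` A) potential b nu x.
  rewrite -ge0_integral_setU ?setUv//.
  - by move=> x _; exact: potential_ge0.
  - by apply/disj_setPS; rewrite setICr.
have sq0 (x : T) : (~` A) x -> 0 <= ((k / 2)%:E * (x ^+ 2)%:E).
  by move=> _; rewrite -EFinM lee_fin mulr_ge0 ?sqr_ge0// divr_ge0// ltW.
have msq : measurable_fun (~` A) (fun x : T => (x ^+ 2)%:E).
  by apply/measurable_EFinP; exact: measurable_funX.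
have hAC : (k / 2)%:E * \int[mu]_(x in ~` A) (x ^+ 2)%:E + mu (~` A) * g%:E <=
    \int[mu]_(x in ~` A) potential b nu x.
  rewrite [X in _ + X]muleC -(integral_cst mu mAC) -ge0_integralZl//; last 2 first.
  - by move=> x _; rewrite lee_fin sqr_ge0.
  - by rewrite lee_fin divr_ge0// ltW.
  rewrite -ge0_integralD//; last first.
    by apply: measurable_funeM.
  apply: ge0_le_integral => //.
  - by move=> x Ax; rewrite adde_ge0// sq0.
  - by apply: emeasurable_funD => //; apply: measurable_funeM.
  - move=> x; rewrite /A/= in_itv/= => Ax.
    have rx : (r ^+ 2 <= x ^+ 2)%R.
      have [xr|xr] := ltP x (- r)%R.
        rewrite -(sqrrN x) ler_sqr ?nnegrE; lra.
      have [xr'|xr'] := ltP r x; first by rewrite ler_sqr ?nnegrE; lra.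
      by exfalso; apply: Ax; rewrite xr xr'.
    apply: le_trans (_ : (k * x ^+ 2)%:E <= _).
      rewrite -EFinM -EFinD lee_fin.
      have : (k * r ^+ 2 <= k * x ^+ 2)%R by rewrite ler_pM2l.
      by lra.
    apply: le_trans (_ : \int[nu]__ (k * x ^+ 2)%:E <= _).
      by rewrite integral_cst// [X in _ * X]probability_setT mule1.
    apply: ge0_le_integral => //.
    + by move=> y _; rewrite lee_fin mulr_ge0 ?sqr_ge0// ltW.
    + apply: (measurableT_comp (measurable_log_kernel mb)).
      exact: measurable_pair1.
    + by move=> y _; exact: (Kk (x, y)).
have mAE : mu A + mu (~` A) = 1.
  rewrite -measureU ?setUv ?setICr//; exact: probability_setT.
apply: le_trans (leeD hA hAC).
by rewrite [leRHS]addeCA [leLHS]addeC -ge0_muleDl// mAE mul1e.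
Qed.

End confinement.

(** * The monotone coupling *)

Section quantile.
Context (R : realType).
Notation T := (measurableTypeR R).
Implicit Types mu nu : probability T R.

Let id_rv : T -> R := idfun.

#[local] HB.instance Definition _ :=
  @isMeasurableFun.Build _ _ _ _ id_rv (@measurable_id _ _ setT).

Lemma distribution_function_rc mu : right_continuous (distribution_function mu).
Proof.
move=> a; apply: fine_cvg; rewrite -distribution_functionE.
exact: (@cdf_right_continuous _ _ _ mu (id_rv : {RV mu >-> R}) a).
Qed.

Lemma distribution_function_y mu : distribution_function mu x @[x --> +oo%R] --> (1%R : R).
Proof. exact/fine_cvg/(@cvg_cdfy1 _ _ _ mu (id_rv : {RV mu >-> R})). Qed.

Lemma distribution_function_Ny mu : distribution_function mu x @[x --> -oo%R] --> (0%R : R).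
Proof. exact/fine_cvg/(@cvg_cdfNy0 _ _ _ mu (id_rv : {RV mu >-> R})). Qed.

(** The generalized inverse of the distribution function.  The value 0 outside
    ]0, 1[ is arbitrary and makes the function total. *)
Definition quantile mu (t : R) : R :=
  if (0 < t < 1)%R then inf [set x | (t <= distribution_function mu x)%R] else 0%R.

(** The Galois connection between quantile and distribution function; its
    nontrivial half is right continuity of the latter. *)
Lemma quantile_le mu (t x : R) : (0 < t < 1)%R ->
  (quantile mu t <= x)%R = (t <= distribution_function mu x)%R.
Proof.
move=> t01; rewrite /quantile t01; move/andP: t01 => [t0 t1].
set S := [set x | _].
have lbS : has_lbound S.
  have /cvgrPdist_lt/(_ _ t0)[y [_ hy]] := distribution_function_Ny mu.
  exists (y - 1)%R => z Sz; rewrite leNgt; apply/negP => zy.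
  have /hy : (z < y)%R by lra.
  rewrite sub0r normrN ger0_norm ?distribution_function_ge0//.
  by move: Sz; rewrite /S/=; lra.
have S0 : S !=set0.
  have e0 : (0 < 1 - t)%R by lra.
  have /cvgrPdist_lt/(_ _ e0)[y [_ hy]] := distribution_function_y mu.
  exists (y + 1)%R; rewrite /S/=.
  have /hy : (y < y + 1)%R by lra.
  by move=> /ltr_normlW; lra.
apply/idP/idP => [|xS]; last exact: (ge_inf lbS).
move=> Sx; rewrite leNgt; apply/negP => Fxt.
have e0 : (0 < t - distribution_function mu x)%R by lra.
have /cvgrPdist_lt/(_ _ e0) := @distribution_function_rc mu x.
case=> d /= d0 hd.
have [z Sz zx] := inf_adherent d0 (conj S0 lbS).
pose y := (Num.max z (x + d / 2))%R.
have yx : (x < y)%R by rewrite /y lt_max; apply/orP; right; lra.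
have yd : (y < x + d)%R.
  by rewrite /y gt_max; apply/andP; split; [move: zx Sx; lra|lra].
have : (`|x - y| < d)%R by rewrite ltr0_norm; lra.
move=> /hd/(_ yx); rewrite distrC => /ltr_normlW.
have : (t <= distribution_function mu y)%R.
  by apply: le_trans Sz _; apply: distribution_function_nd; rewrite /y le_max lexx.
lra.
Qed.

Lemma measurable_quantile mu : measurable_fun [set: T] (quantile mu : T -> T).
Proof.
apply: (measurability _ (RGenOInfty.measurableE R)) => // _ [_ [a ->] <-].
rewrite setTI (_ : _ @^-1` _ = [set t | if (0 < t < 1)%R
    then (distribution_function mu a < t)%R else (a < 0)%R]).
  apply: measurable_boolset; apply: measurable_fun_ifT => //.
    by apply: measurable_and; apply: measurable_fun_ltr.
  exact: measurable_fun_ltr.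
apply/seteqP; split=> t /=; rewrite in_itv/= andbT.
  case: ifPn => t01; first by rewrite !ltNge quantile_le.
  by rewrite /quantile (negbTE t01).
case: ifPn => t01; first by rewrite !ltNge quantile_le.
by rewrite /quantile (negbTE t01).
Qed.

Definition unit_lebesgue : set T -> \bar R :=
  mrestr lebesgue_measure (measurable_itv `]0%R, 1%R[ : measurable (`]0%R, 1%R[%classic : set T)).

HB.instance Definition _ := Measure.on unit_lebesgue.

Let unit_lebesgue_setT : unit_lebesgue setT = 1.
Proof.
transitivity (@lebesgue_measure R (setT `&` `]0%R, 1%R[%classic)) => //.
by rewrite setTI lebesgue_measure_itv/= lte01 sube0.
Qed.

HB.instance Definition _ :=
  Measure_isProbability.Build _ _ _ unit_lebesgue unit_lebesgue_setT.

(** Uniform measure of an event that amounts to t <= c; the two shapes of the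
    interval, for c < 1 and c = 1, are treated apart. *)
Lemma unit_lebesgue_le (c : R) (B : set T) : measurable B -> (0 <= c <= 1)%R ->
  (forall t, 0 < t < 1 -> B t <-> t <= c)%R -> unit_lebesgue B = c%:E.
Proof.
move=> mB /andP[c0 c1] Bc.
transitivity (@lebesgue_measure R (B `&` `]0%R, 1%R[%classic)) => //.
move: c1; rewrite le_eqVlt => /predU1P[c1|c1].
  rewrite (_ : _ `&` _ = `]0%R, 1%R[%classic).
    by rewrite lebesgue_measure_itv/= lte01 sube0 c1.
  apply/seteqP; split=> t [] //=; rewrite in_itv/= => t01; split => //.
  by apply/Bc => //; rewrite c1; case/andP: t01 => _ /ltW.
rewrite (_ : _ `&` _ = `]0%R, c]%classic).
  rewrite lebesgue_measure_itv/= lte_fin sube0; case: ltP => // c0'.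
  by congr (_%:E); apply/eqP; rewrite eq_le c0 c0'.
apply/seteqP; split=> t /=; rewrite !in_itv/=.
  by move=> [Bt t01]; case/andP: (t01) => -> _ /=; exact/Bc.
move=> /andP[t0 tc]; have t01 : (0 < t < 1)%R by rewrite t0 (le_lt_trans tc).
by split => //; exact/Bc.
Qed.

Lemma eq_probability mu nu : distribution_function mu =1 distribution_function nu ->
  forall A : set T, measurable A -> mu A = nu A.
Proof.
move=> munu A mA.
pose g (n : nat) : set T := `](- n%:R)%R, n%:R]%classic.
apply: (@measure_unique _ R T (@ocitv R) g _ _ _ _ mu nu) => //.
- exact: ocitvI.
- by move=> n; exists ((- n%:R)%R, n%:R).
- apply/seteqP; split=> // x _.
  exists (Num.truncn `|x|).+1 => //=; rewrite /g/= in_itv/=.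
  have xn : (`|x| < (Num.truncn `|x|).+1%:R)%R by rewrite truncnS_gt.
  have := ler_norm x; have := ler_norm (- x)%R; rewrite normrN => ? ?.
  by apply/andP; split; lra.
- move=> _ [[a b] _ <-]/=; have [ab|ba] := leP a b.
    by rewrite !measure_itv_oc// !munu.
  have -> : `]a, b]%classic = set0 :> set R.
    by rewrite set_itv_ge// bnd_simp -leNgt ltW.
  by rewrite [LHS]measure0 [RHS]measure0.
- move=> n; rewrite -ge0_fin_numE//; apply: fin_num_measure.
  exact: measurable_itv.
Qed.

Definition quantile_pair mu nu (t : T) : T * T := (quantile mu t, quantile nu t).

Lemma measurable_quantile_pair mu nu : measurable_fun [set: T] (quantile_pair mu nu).
Proof. by apply: measurable_fun_pair; exact: measurable_quantile. Qed.

HB.instance Definition _ mu nu :=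
  @isMeasurableFun.Build _ _ _ _ (quantile_pair mu nu)
    (measurable_quantile_pair mu nu).

HB.instance Definition _ mu :=
  @isMeasurableFun.Build _ _ _ _ (quantile mu : T -> T) (@measurable_quantile mu).

Definition quantile_law mu : probability T R :=
  distribution unit_lebesgue (quantile mu : T -> T).

Lemma quantile_lawE mu (A : set T) : measurable A ->
  unit_lebesgue (quantile mu @^-1` A) = mu A.
Proof.
move=> mA; apply: (@eq_probability (quantile_law mu)) => // x.
apply/EFin_inj; rewrite -[LHS]distribution_functionE.
apply: unit_lebesgue_le => /=.
- rewrite -[X in measurable X]setTI; exact: measurable_quantile.
- by rewrite distribution_function_ge0 distribution_function_le1.
- by move=> t t01; rewrite in_itv/= quantile_le.
Qed.

Definition quantile_coupling mu nu : probability (T * T)%type R :=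
  distribution unit_lebesgue (quantile_pair mu nu).

Lemma coupling_quantile mu nu : coupling mu nu (quantile_coupling mu nu).
Proof. by move=> A mA; split; exact: quantile_lawE. Qed.

(** Layer-cake form of the distance: |a - b| is the length of the set of all x
    separating a from b. *)
Lemma dist_integral (a b : R) :
  `|a - b|%R%:E = \int[lebesgue_measure]_x
    (\1_[set x : T | (a <= x < b)%R || (b <= x < a)%R] x)%:E.
Proof.
wlog ab : a b / (a <= b)%R => [hwlog|].
  have [|ba] := leP a b; first exact: hwlog.
  rewrite distrC hwlog ?(ltW ba)//; apply: eq_integral => x _.
  by congr (\1_ _ _)%:E; apply/seteqP; split=> y /=; rewrite orbC.
rewrite (_ : [set x : T | _] = `[a, b[%classic).
  transitivity (@lebesgue_measure R `[a, b[%classic); last first.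
    by rewrite integral_indic// setIT.
  rewrite lebesgue_measure_itv/= lte_fin.
  rewrite distrC ger0_norm ?subr_ge0//; case: ltP => //= ba.
  by congr (_%:E); lra.
apply/seteqP; split=> x /=; rewrite in_itv/=; last by move=> ->.
by move=> /orP[//|/andP[? ?]]; exfalso; lra.
Qed.

(** The cost of the monotone coupling, by [dist_integral] and Tonelli: for fixed
    x, the t for which x separates the two quantiles form an interval with end
    points F_mu(x) and F_nu(x). *)
Lemma wasserstein1_le_distribution mu nu :
  wasserstein1 mu nu <= \int[lebesgue_measure]_x
    `|distribution_function mu x - distribution_function nu x|%R%:E.
Proof.
apply: le_trans (_ : \int[quantile_coupling mu nu]_z `|z.1 - z.2|%R%:E <= _).
  by apply: ereal_inf_lbound; exists (quantile_coupling mu nu) => //; exact: coupling_quantile.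
rewrite ge0_integral_distribution//; last first.
  by apply/measurable_EFinP; exact: measurable_dist.
pose b (p : T * T) := ((quantile mu p.1 <= p.2 < quantile nu p.1) ||
  (quantile nu p.1 <= p.2 < quantile mu p.1))%R.
have mb : measurable [set p | b p].
  have mq m : measurable_fun setT (fun p : T * T => quantile m p.1).
    exact: (measurableT_comp (measurable_quantile m) measurable_fst).
  apply: measurable_boolset; apply: measurable_or; apply: measurable_and;
    by [exact: measurable_fun_ler|exact: measurable_fun_ltr].
have mf : measurable_fun setT (fun p : T * T => (\1_[set p | b p] p : R)%:E).
  by apply/measurable_EFinP; exact: measurable_indic.
under eq_integral do rewrite /= dist_integral.
rewrite (@tonelli_lebesgue _ _ _ unit_lebesgue (fun p => (\1_[set p | b p] p)%:E))//.
have mF m := measurable_distribution_function m.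
apply: ge0_le_integral => //.
- by move=> x _; exact: integral_ge0.
- exact: (measurable_fun_fubini_tonelli_G (m1 := unit_lebesgue) (fun p => (\1_[set p | b p] p)%:E)).
- apply/measurable_EFinP; apply: (measurableT_comp (@normr_measurable R setT)).
  by apply: measurable_funB; exact: mF.
move=> x _.
have mbx : measurable [set t : T | b (t, x)].
  rewrite -[X in measurable X]setTI.
  exact: (@measurable_pair2 _ _ _ _ x measurableT _ mb).
rewrite (_ : (fun t : T => _) = (fun t => (\1_[set t | b (t, x)] t)%:E))//.
rewrite integral_indic// setIT.
pose u := distribution_function mu x; pose v := distribution_function nu x.
rewrite -/u -/v.
apply: le_trans (_ : @lebesgue_measure R `]Num.min u v, Num.max u v]%classic <= _).
  rewrite [leLHS](_ : _ = @lebesgue_measure R ([set t : T | b (t, x)] `&` `]0%R, 1%R[%classic))//.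
  apply: le_measure; rewrite ?inE//; first exact: measurableI.
  move=> t [/=]; rewrite /b/= in_itv/= => bt t01; rewrite in_itv/=.
  move: bt; rewrite !ltNge !quantile_le// -!ltNge -/u -/v.
  by rewrite gt_min le_max => /orP[/andP[-> ->]|/andP[-> ->]]; rewrite ?orbT.
rewrite lebesgue_measure_itv/= lte_fin; case: ifPn => _; last by rewrite lee_fin.
rewrite -EFinB lee_fin; have [uv|uv] := leP u v; last exact: ler_norm.
by rewrite distrC ler_norm.
Qed.

End quantile.

(** * From window masses to transport cost *)

Section transport_bound.
Context (R : realType).
Notation T := (measurableTypeR R).
Implicit Types mu nu : probability T R.

Lemma measure_itv_oy mu (x : R) :
  mu `]x, +oo[%classic = (1 - distribution_function mu x)%:E.
Proof.
rewrite EFinB -distribution_functionE -setCitvl.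
by rewrite [LHS]probability_setC.
Qed.

Lemma itv_subset_tail_right (r x : R) : (r <= x)%R ->
  `]x, +oo[%classic `<=` ~` `[(- r)%R, r]%classic.
Proof.
move=> rx y /=; rewrite !in_itv/= andbT => xy /andP[_ yr]; lra.
Qed.

Lemma itv_subset_tail_left (r x : R) : (x < - r)%R ->
  `]-oo, x]%classic `<=` ~` `[(- r)%R, r]%classic.
Proof. by move=> rx y /=; rewrite !in_itv/= => xy /andP[? _]; lra. Qed.

Lemma tail_mass_le mu (r : R) : (0 <= r)%R ->
  (r ^+ 2)%:E * mu (~` `[(- r)%R, r]%classic) <=
  \int[mu]_(x in ~` `[(- r)%R, r]) (x ^+ 2)%:E.
Proof.
move=> r0; have mA : measurable (~` `[(- r)%R, r]%classic : set T).
  by apply: measurableC; exact: measurable_itv.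
rewrite -integral_cst//; apply: ge0_le_integral => //.
- by move=> y _; rewrite lee_fin sqr_ge0.
- by apply/measurable_EFinP; exact: measurable_funX.
- move=> y /=; rewrite in_itv/= => yA; rewrite lee_fin.
  rewrite -(real_normK (num_real y)) ler_sqr ?nnegrE//.
  rewrite leNgt; apply/negP; rewrite ltr_norml => /andP[/ltW h1 /ltW h2].
  by apply: yA; rewrite h1.
Qed.

(** A form of the inequality between arithmetic and geometric means.  Using it
    with one free l for all terms replaces the Cauchy-Schwarz inequality. *)
Lemma ler_weighted_sqr (l u : R) : (0 < l)%R -> (0 <= u)%R ->
  (u <= l * u ^+ 2 + l^-1)%R.
Proof.
move=> l0 u0; rewrite -(ler_pM2l l0).
rewrite (_ : l * (l * u ^+ 2 + l^-1) = (l * u) ^+ 2 + 1)%R; last by field; lra.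
have lu0 : (0 <= l * u)%R by rewrite mulr_ge0// ltW.
have := sqr_ge0 (l * u - 1)%R; nra.
Qed.

(** Real arithmetic for [wasserstein1_le_linear]: tau stands for the mass and t
    for the second moment of mu off [-r, r]. *)
Lemma weighted_tail_bound (r l tau t : R) : (0 < r)%R -> (0 < l)%R ->
  (0 <= tau)%R -> (tau <= 1)%R -> (r ^+ 2 * tau <= t)%R ->
  ((l^-1 + tau) * (2 * r) + (l * t + l^-1) <=
   l * ((2 / r + 1) * t) + (4 * r + 1) / l)%R.
Proof.
move=> r0 l0 tau0 tau1 taut.
have tau_l := ler_weighted_sqr l0 tau0.
have tausq : (l * tau ^+ 2 <= l * tau)%R by rewrite ler_pM2l// expr2 ler_piMl.
have h1 : (r * tau <= l * (r * tau) + r / l)%R.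
  rewrite (_ : l * (r * tau) + r / l = r * (l * tau + l^-1))%R; last by ring.
  by rewrite ler_pM2l//; lra.
have h2 : (l * (r * tau) <= l * (t / r))%R.
  rewrite ler_pM2l// ler_pdivlMr//.
  by rewrite (_ : r * tau * r = r ^+ 2 * tau)%R//; ring.
rewrite (_ : (l^-1 + tau) * (2 * r) + (l * t + l^-1) =
  2 * (r / l) + 2 * (r * tau) + l * t + l^-1)%R; last by ring.
rewrite (_ : l * ((2 / r + 1) * t) + (4 * r + 1) / l =
  2 * (l * (t / r)) + l * t + 4 * (r / l) + l^-1)%R; last by ring.
lra.
Qed.

Section supported.
Variables (r : R) (mu nu : probability T R).
Hypothesis r0 : (0 < r)%R.
Let A : set T := `[(- r)%R, r]%classic.
Hypothesis nuA : nu (~` A) = 0.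

Let mAC : measurable (~` A).
Proof. by apply: measurableC; exact: measurable_itv. Qed.

Let F0 x : (x < - r)%R -> distribution_function nu x = 0%R.
Proof.
move=> xr; apply/eqP; rewrite eq_le distribution_function_ge0 andbT.
rewrite -lee_fin -distribution_functionE.
apply: le_trans (_ : nu (~` A) <= _); last by rewrite nuA.
by apply: le_measure; rewrite ?inE//; exact: itv_subset_tail_left.
Qed.

Let F1 x : (r <= x)%R -> distribution_function nu x = 1%R.
Proof.
move=> xr; apply/eqP; rewrite eq_le distribution_function_le1/=.
rewrite -subr_le0 -lee_fin -measure_itv_oy.
apply: le_trans (_ : nu (~` A) <= _); last by rewrite nuA.
by apply: le_measure; rewrite ?inE//; exact: itv_subset_tail_right.
Qed.

Let G x := (distribution_function mu x - distribution_function nu x)%R.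
Let tau := fine (mu (~` A)).

Let mG : measurable_fun [set: T] (fun x => `|G x|%R : R).
Proof.
apply: (measurableT_comp (@normr_measurable R setT)).
by apply: measurable_funB; exact: measurable_distribution_function.
Qed.

(** The window ]a, a+s] reaches beyond r, where nu has no mass left and mu at
    most tau; its two masses therefore determine F_nu(a) - F_mu(a) up to tau. *)
Let inside s a : (2 * r <= s)%R -> (- r <= a)%R ->
  (`|G a| <= `|(distribution_function mu (a + s) - distribution_function mu a) -
    (distribution_function nu (a + s) - distribution_function nu a)| + tau)%R.
Proof.
move=> rs ra.
have ras : (r <= (a + s)%R)%R by lra.
rewrite (F1 ras).
have htau : (1 - distribution_function mu (a + s) <= tau)%R.
  rewrite -lee_fin -measure_itv_oy /tau fineK ?fin_num_measure//.
  by apply: le_measure; rewrite ?inE//; exact: itv_subset_tail_right.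
have := distribution_function_le1 mu (a + s).
set p := distribution_function mu (a + s) in htau *.
set u := (_ - (1 - _))%R; move=> p1.
have -> : G a = (- u - (1 - p))%R by rewrite /G /u; ring.
apply: le_trans (ler_normB _ _) _; rewrite normrN lerD2l.
by rewrite ger0_norm// subr_ge0.
Qed.

(** For x off A, |F_mu(x) - F_nu(x)| is the mass that mu puts beyond x; for fixed
    y, the x off A with y beyond x form, when |y| > r, an interval of length |y| - r. *)
Let outside : \int[lebesgue_measure]_(x in ~` A) `|G x|%R%:E <=
  \int[mu]_(y in ~` A) `|y|%R%:E.
Proof.
have rNr : (r < - r)%R = false by rewrite ltNge (le_trans _ (ltW r0))// oppr_le0 ltW.
pose b (p : T * T) := ((r < p.2) && (p.2 < p.1) || ((p.1 <= p.2) && (p.2 < - r)))%R.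
have mb : measurable [set p | b p].
  have m1 : measurable_fun setT (fun p : T * T => p.1) by exact: measurable_fst.
  have m2 : measurable_fun setT (fun p : T * T => p.2) by exact: measurable_snd.
  apply: measurable_boolset; apply: measurable_or; apply: measurable_and;
    by [exact: measurable_fun_ltr|exact: measurable_fun_ler].
have mf : measurable_fun setT (fun p : T * T => (\1_[set p | b p] p : R)%:E).
  by apply/measurable_EFinP; exact: measurable_indic.
have f0 : forall p : T * T, 0 <= (\1_[set p | b p] p : R)%:E by move=> p; rewrite lee_fin.
apply: le_trans (_ : \int[lebesgue_measure]_x \int[mu]_y (\1_[set p | b p] (y, x))%:E <= _).
  rewrite integral_mkcond; apply: ge0_le_integral => //.
  - move=> x _; rewrite /patch; case: ifP => // _; rewrite lee_fin//.
  - apply/(measurable_restrict _ mAC measurableT); rewrite setTI.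
    by apply/measurable_EFinP; exact: measurable_funTS.
  - exact: (measurable_fun_fubini_tonelli_G (m1 := mu) (fun p => (\1_[set p | b p] p)%:E)).
  move=> x _; rewrite /patch; case: ifP => [|_]; last exact: integral_ge0.
  rewrite inE /A/= in_itv/= => xA.
  have mbx : measurable [set t : T | b (t, x)].
    rewrite -[X in measurable X]setTI.
    exact: (@measurable_pair2 _ _ _ _ x measurableT _ mb).
  rewrite [leRHS](_ : _ = mu [set t : T | b (t, x)]); last first.
    by rewrite -[in RHS](setIT [set _ | _]) -integral_indic.
  have [xr|xr] := ltP x (- r)%R.
    rewrite /G (F0 xr) subr0 ger0_norm ?distribution_function_ge0//.
    rewrite -distribution_functionE; apply: le_measure; rewrite ?inE//.
    by move=> y /=; rewrite in_itv/= /b/= xr andbT => ->; rewrite orbT.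
  have rx : (r < x)%R by rewrite ltNge; apply/negP => xr'; apply: xA; rewrite xr xr'.
  rewrite /G (F1 (ltW rx)) distrC ger0_norm ?subr_ge0 ?distribution_function_le1//.
  rewrite -measure_itv_oy; apply: le_measure; rewrite ?inE//.
  by move=> y /=; rewrite in_itv/= /b/= rx andbT => ->.
rewrite -(@tonelli_lebesgue _ _ _ mu (fun p => (\1_[set p | b p] p)%:E))//.
rewrite [leRHS]integral_mkcond; apply: ge0_le_integral => //.
- by move=> y _; exact: integral_ge0.
- exact: (measurable_fun_fubini_tonelli_F (m2 := lebesgue_measure)
    (fun p => (\1_[set p | b p] p)%:E)).
- apply/(measurable_restrict _ mAC measurableT); rewrite setTI.
  by apply/measurable_EFinP; exact: measurable_funTS.
move=> y _.
have mby : measurable [set x : T | b (y, x)].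
  rewrite -[X in measurable X]setTI.
  exact: (@measurable_pair1 _ _ _ _ y measurableT _ mb).
rewrite [leLHS](_ : _ = @lebesgue_measure R [set x : T | b (y, x)]); last first.
  by rewrite -[in RHS](setIT [set _ | _]) -integral_indic.
have [yr|yr] := ltP y (- r)%R.
  rewrite /patch ifT; last first.
    by rewrite inE /A/= in_itv/=; apply/negP; rewrite negb_and -ltNge yr.
  apply: le_trans (_ : @lebesgue_measure R `[y, (- r)%R]%classic <= _).
    apply: le_measure; rewrite ?inE//.
    move=> x /=; rewrite /b/= in_itv/= => /orP[/andP[rx xy]|/andP[-> /ltW ->]//].
    by have := lt_trans (lt_trans rx xy) yr; rewrite rNr.
  rewrite lebesgue_measure_itv/= lte_fin yr -EFinB lee_fin.
  have y0 : ((y : R) < 0)%R by apply: lt_trans yr _; rewrite oppr_lt0.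
  by rewrite (ltr0_norm y0) gerDr oppr_le0 ltW.
have [ry|ry] := ltP r y.
  rewrite /patch ifT; last first.
    by rewrite inE /A/= in_itv/=; apply/negP; rewrite negb_and -!ltNge ry orbT.
  apply: le_trans (_ : @lebesgue_measure R `[r, y]%classic <= _).
    apply: le_measure; rewrite ?inE//.
    move=> x /=; rewrite /b/= in_itv/= => /orP[/andP[/ltW -> /ltW ->]//|/andP[yx xr]].
    by have := lt_trans (lt_le_trans ry yx) xr; rewrite rNr.
  rewrite lebesgue_measure_itv/= lte_fin ry -EFinB lee_fin.
  have y0 : (0 < (y : R))%R by apply: lt_trans ry.
  by rewrite (gtr0_norm y0) gerDl oppr_le0 ltW.
rewrite (_ : [set x | _] = set0) ?measure0; last first.
  apply/seteqP; split=> // x /=; rewrite /b/= => /orP[|] /andP[h1 h2].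
    by have := lt_le_trans (lt_trans h1 h2) ry; rewrite ltxx.
  by have := lt_le_trans (le_lt_trans h1 h2) yr; rewrite ltxx.
by rewrite /patch; case: ifP.
Qed.

Lemma wasserstein1_le_linear (s l : R) (t : R) : (2 * r <= s)%R -> (0 < l)%R ->
  \int[mu]_(y in ~` A) (y ^+ 2)%:E = t%:E ->
  wasserstein1 mu nu <= l%:E * increment_gap mu nu s +
    (l * ((2 / r + 1) * t) + (4 * r + 1) / l)%:E.
Proof.
move=> rs l0 tE.
have mA : measurable A by exact: measurable_itv.
have linear (u : R) : (0 <= u)%R -> (u <= l * u ^+ 2 + l^-1)%R by exact: ler_weighted_sqr.
have linv : (0 < l^-1)%R by rewrite invr_gt0.
have tau0 : (0 <= tau)%R by exact: fine_ge0.
have tau1 : (tau <= 1)%R by rewrite -lee_fin /tau fineK ?fin_num_measure// probability_le1.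
have taut : (r ^+ 2 * tau <= t)%R.
  by rewrite -lee_fin -tE EFinM /tau fineK ?fin_num_measure// tail_mass_le// ltW.
have sqm (D : set T) : measurable_fun D (fun y : T => (y ^+ 2)%:E).
  by apply/measurable_EFinP; exact: measurable_funX.
apply: le_trans (wasserstein1_le_distribution mu nu) _.
have -> : \int[lebesgue_measure]_x `|G x|%R%:E = \int[lebesgue_measure]_(x in A) `|G x|%R%:E +
    \int[lebesgue_measure]_(x in ~` A) `|G x|%R%:E.
  rewrite -ge0_integral_setU ?setUv//.
  - by apply/measurable_EFinP.
  - by apply/disj_setPS; rewrite setICr.
have outl : \int[mu]_(y in ~` A) `|y|%R%:E <= (l * t + l^-1)%:E.
  apply: le_trans (_ : \int[mu]_(y in ~` A) (l%:E * (y ^+ 2)%:E + (l^-1)%:E) <= _).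
    apply: ge0_le_integral => //.
    - by apply/measurable_EFinP; exact: measurable_funTS.
    - by apply: emeasurable_funD => //; apply: measurable_funeM.
    - by move=> y _; rewrite -EFinM -EFinD lee_fin -(real_normK (num_real y)) linear.
  rewrite ge0_integralD//; last 3 first.
  - by move=> y _; rewrite -EFinM lee_fin mulr_ge0 ?sqr_ge0// ltW.
  - exact: measurable_funeM.
  - by move=> y _; rewrite lee_fin ltW.
  rewrite ge0_integralZl//; last 2 first.
  - by move=> y _; rewrite lee_fin sqr_ge0.
  - by rewrite lee_fin ltW.
  rewrite tE integral_cst// -EFinM EFinD leeD2l//.
  rewrite [X in _ * X <= _](_ : _ = tau%:E); last first.
    by rewrite /tau fineK// fin_num_measure.
  rewrite -EFinM lee_fin.
  by rewrite ler_piMr// ltW.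
pose sg a := ((distribution_function mu (a + s) - distribution_function mu a) -
    (distribution_function nu (a + s) - distribution_function nu a))%R.
have msg : measurable_fun [set: T] (fun a => ((sg a) ^+ 2)%:E).
  apply/measurable_EFinP; apply: measurable_funX; apply: measurable_funB;
  exact: measurable_increment.
have inl : \int[lebesgue_measure]_(x in A) `|G x|%R%:E <=
    l%:E * increment_gap mu nu s + ((l^-1 + tau) * (2 * r))%:E.
  apply: le_trans (_ : \int[lebesgue_measure]_(x in A)
      (l%:E * ((sg x) ^+ 2)%:E + (l^-1 + tau)%:E) <= _).
    apply: ge0_le_integral => //.
    - by apply/measurable_EFinP; exact: measurable_funTS.
    - apply: emeasurable_funD => //; apply: measurable_funeM; exact: measurable_funTS.
    - move=> x; rewrite /A/= in_itv/= => /andP[rx _].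
      rewrite -EFinM -EFinD lee_fin.
      apply: le_trans (inside rs rx) _.
      rewrite addrA lerD2r -(real_normK (num_real (sg x))); exact: linear.
  rewrite ge0_integralD//; last 3 first.
  - by move=> y _; rewrite -EFinM lee_fin mulr_ge0 ?sqr_ge0// ltW.
  - apply: measurable_funeM; exact: measurable_funTS.
  - by move=> y _; rewrite lee_fin addr_ge0// ltW.
  rewrite ge0_integralZl//; last 3 first.
  - exact: measurable_funTS.
  - by move=> y _; rewrite lee_fin sqr_ge0.
  - by rewrite lee_fin ltW.
  apply: leeD.
    apply: lee_wpmul2l; first by rewrite lee_fin ltW.
    apply: ge0_subset_integral => //.
    by move=> y _; rewrite lee_fin sqr_ge0.
  have lebA : @lebesgue_measure R `[(- r)%R, r]%classic = (2 * r)%:E.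
    rewrite lebesgue_measure_itv/= lte_fin gtrN// -EFinB.
    by congr (_%:E); ring.
  by rewrite integral_cst// [X in _ * X](_ : _ = (2 * r)%:E)//.
apply: le_trans (leeD inl (le_trans outside outl)) _.
rewrite -addeA leeD2l// -EFinD lee_fin.
exact: weighted_tail_bound.
Qed.

End supported.

End transport_bound.

(** * Averaging over window lengths, and the growth of the potential *)

Section averaging.
Context (R : realType).
Notation T := (measurableTypeR R).
Implicit Types mu nu : probability T R.

Lemma wasserstein1_ge0 mu nu : 0 <= wasserstein1 mu nu.
Proof.
by apply: le_ereal_inf_tmp => _ [p _ <-]; apply: integral_ge0 => z _; rewrite lee_fin.
Qed.

(** Averages [wasserstein1_le_linear] over s in [2r, 3r], where 1 <= 9 r^2 s^-2. *)
Lemma wasserstein1_le_smoothed_gap (r : R) mu nu (l t q : R) : (0 < r)%R ->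
  nu (~` `[(- r)%R, r]%classic) = 0 -> (0 < l)%R ->
  \int[mu]_(y in ~` `[(- r)%R, r]) (y ^+ 2)%:E = t%:E ->
  smoothed_gap mu nu (3 * r) = q%:E ->
  wasserstein1 mu nu <=
    (l * (9 * r * q + (2 / r + 1) * t) + (4 * r + 1) / l)%:E.
Proof.
move=> r0 nur l0 tE qE.
pose K := (l * ((2 / r + 1) * t) + (4 * r + 1) / l)%R.
pose D : set T := `[(2 * r)%R, (3 * r)%R]%classic.
have mD : measurable D by exact: measurable_itv.
have lebD : @lebesgue_measure R D = r%:E.
  rewrite lebesgue_measure_itv/= lte_fin ifT; last by lra.
  by rewrite -EFinB; congr (_%:E); lra.
have mgap (E : set T) : measurable_fun E (fun s : T => (s ^- 2)%:E * increment_gap mu nu s).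
  apply: emeasurable_funM; last exact: measurable_increment_gap.
  by apply/measurable_EFinP; exact: measurable_invX2.
have gap0 (s : T) : 0 <= (s ^- 2)%:E * increment_gap mu nu s.
  by rewrite mule_ge0 ?invX2_ge0 ?increment_gap_ge0.
have c0 : (0 <= 9 * r ^+ 2 * l)%R by rewrite !mulr_ge0 ?sqr_ge0// ltW.
have t0 : (0 <= t)%R.
  by rewrite -lee_fin -tE; apply: integral_ge0 => y _; rewrite lee_fin sqr_ge0.
have K0 : (0 <= K)%R.
  by rewrite addr_ge0 ?mulr_ge0 ?addr_ge0 ?divr_ge0 ?mulr_ge0 ?invr_ge0//; lra.
have : r%:E * wasserstein1 mu nu <= r%:E * (9 * r * l * q + K)%:E.
  rewrite -[X in X * _ <= _]lebD muleC -integral_cst//.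
  apply: le_trans (_ : \int[lebesgue_measure]_(s in D)
     ((9 * r ^+ 2 * l)%:E * ((s ^- 2)%:E * increment_gap mu nu s) + K%:E) <= _).
    apply: ge0_le_integral => //.
    - by move=> s _; exact: wasserstein1_ge0.
    - by apply: emeasurable_funD => //; exact: measurable_funeM.
    - move=> s; rewrite /D/= in_itv/= => /andP[s2 s3].
      have /le_trans := wasserstein1_le_linear r0 nur s2 l0 tE; apply.
      apply: leeD2r; rewrite muleA; apply: lee_wpmul2r; first exact: increment_gap_ge0.
      have s0 : (0 < s)%R by apply: lt_le_trans s2; lra.
      rewrite -EFinM lee_fin ler_pdivlMr ?exprn_gt0// mulrC ler_pM2r//.
      rewrite (_ : 9 * r ^+ 2 = (3 * r) ^+ 2)%R; last by ring.
      by rewrite ler_sqr ?nnegrE// ?ltW//; lra.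
  rewrite ge0_integralD//; last 2 first.
  - by move=> s _; rewrite mule_ge0.
  - exact: measurable_funeM.
  rewrite ge0_integralZl// integral_cst// [X in _ + _ * X <= _](_ : _ = r%:E)//.
  rewrite [leRHS](_ : _ = ((9 * r ^+ 2 * l) * q)%:E + (K * r)%:E); last first.
    by rewrite -EFinM -EFinD; congr (_%:E); ring.
  apply: leeD; last by rewrite -EFinM.
  rewrite [leRHS]EFinM -qE; apply: lee_wpmul2l; first by rewrite lee_fin.
  apply: ge0_subset_integral => //.
  by move=> s; rewrite /D/= !in_itv/= => /andP[s2 ->]; rewrite (le_trans _ s2)//; lra.
rewrite lee_pmul2l// ?lte_fin// => /le_trans; apply.
by rewrite lee_fin /K; lra.
Qed.

(** The choice l = 2 c / w makes the last term w/2, which is absorbed. *)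
Lemma sqr_le_of_linear (w : \bar R) (X c : R) : 0 <= w -> (0 <= X)%R -> (0 < c)%R ->
  (forall l : R, (0 < l)%R -> w <= (l * X + c / l)%:E) -> w ^+ 2 <= (4 * c * X)%:E.
Proof.
move=> w0 X0 c0 h.
have wf : w \is a fin_num.
  by rewrite ge0_fin_numE//; apply: le_lt_trans (h 1%R ltr01) _; rewrite ltry.
move: w0 h; rewrite -(fineK wf); set u := fine w; rewrite lee_fin => u0 h.
rewrite -EFin_expe lee_fin.
move: u0; rewrite le_eqVlt => /predU1P[<-|u0].
  by rewrite expr0n/= !mulr_ge0// ltW.
have l0 : (0 < 2 * c / u)%R by rewrite divr_gt0// mulr_gt0.
have := h _ l0; rewrite lee_fin.
rewrite (_ : _ + _ = (2 * c * X) / u + u / 2)%R; last by field; lra.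
move=> h1; have : (u * u <= u * ((2 * c * X) / u + u / 2))%R by rewrite ler_pM2l.
rewrite (_ : u * (_ + _) = 2 * c * X + u * u / 2)%R; last by field; lra.
rewrite expr2; lra.
Qed.

End averaging.

Section integral_shift.
Context d (T : measurableType d) (R : realType) (P : probability T R).

(** The integral of f may be infinite, so the positive and negative parts h^+ and
    h^- of f - C are compared through h^+ + C = f + h^-; the integral of h^- is
    at most C. *)
Lemma ge0_integral_shift (f : T -> \bar R) (C : R) : measurable_fun setT f ->
  (forall x, 0 <= f x) -> (0 <= C)%R ->
  \int[P]_x (f x - C%:E) = \int[P]_x f x - C%:E.
Proof.
move=> mf f0 C0.
have PC : \int[P]_x C%:E = C%:E.
  by rewrite integral_cst// [X in _ * X]probability_setT mule1.
rewrite integralE; set h := fun x => f x - C%:E.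
have mh : measurable_fun setT h by apply: emeasurable_funB.
have hn0 : 0 <= \int[P]_x h^\- x by apply: integral_ge0.
have hnC : \int[P]_x h^\- x <= C%:E.
  rewrite -PC.
  apply: ge0_le_integral => //; first exact: measurable_funeneg.
  move=> x _; rewrite funenegE /h ge_max oppeB//; last by rewrite fin_num_adde_defl.
  by rewrite lee_fin C0 andbT geeDr// oppe_le0.
have hnf : \int[P]_x h^\- x \is a fin_num.
  by rewrite ge0_fin_numE//; apply: le_lt_trans hnC _; rewrite ltry.
have : \int[P]_x h^\+ x + C%:E = \int[P]_x f x + \int[P]_x h^\- x.
  rewrite -ge0_integralD//; last exact: measurable_funeneg.
  transitivity (\int[P]_x (h^\+ x + C%:E)).
    rewrite ge0_integralD//; last exact: measurable_funepos.
    by rewrite PC.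
  apply: eq_integral => x _; rewrite funeposE funenegE /h.
  case: (f x) (f0 x) => [y| |]//; last by move=> _ /=; rewrite maxye maxNye.
  move=> _; rewrite -EFinB -EFinN -!EFin_max -!EFinD; congr (_%:E).
  have [yC|yC] := leP 0%R (y - C)%R.
    have -> : (Num.max (- (y - C)) 0 = 0 :> R)%R by apply/max_idPr; lra.
    by rewrite subrK addr0.
  have -> : (Num.max (- (y - C)) 0 = - (y - C) :> R)%R by apply/max_idPl; lra.
  lra.
move=> /(congr1 (fun u => u - C%:E - \int[P]_x h^\- x)).
rewrite addeK// => ->.
by rewrite addeAC addeK.
Qed.

End integral_shift.

Section growth.
Context (R : realType).

(** Far out this is the growth condition; B absorbs the bounded region. *)
Lemma quadratic_minorant (V : R -> R) : has_lbound (range V) ->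
  0 < limf_einf (fun x : R => (V x / x ^+ 2)%R%:E) (@abs_infty R) ->
  exists c B : R, [/\ (0 < c)%R, (0 <= B)%R & forall x, (c * x ^+ 2 <= V x + B)%R].
Proof.
move=> [m lbm]; rewrite limf_einfE => /ereal_sup_gt[_ [W [r _ rW] <-]] e0.
have [c [c0 hc]] : exists c : R, (0 < c)%R /\ forall x, (r < `|x|)%R -> (c <= V x / x ^+ 2)%R.
  have lb x : (r < `|x|)%R -> ereal_inf [set (V x / x ^+ 2)%R%:E | x in W] <= (V x / x ^+ 2)%:E.
    by move=> rx; apply: ereal_inf_lbound; exists x => //; exact: rW.
  move: e0 lb; case: (ereal_inf _) => [e| |]// e0 lb.
  - by exists e; split=> // x /lb; rewrite lee_fin.
  - by exists 1%R; split=> // x /lb; rewrite leye_eq.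
pose s := Num.max r 0%R.
have cs0 : (0 <= c * s ^+ 2)%R by rewrite mulr_ge0 ?sqr_ge0// ltW.
exists c, (`|m| + c * s ^+ 2)%R; split => //; first by rewrite addr_ge0.
move=> x; have [xs|sx] := leP `|x|%R s.
  have Vm : (m <= V x)%R by apply: lbm; exists x.
  have : (c * x ^+ 2 <= c * s ^+ 2)%R.
    rewrite ler_pM2l// -(real_normK (num_real x)) ler_sqr ?nnegrE//.
    by rewrite /s le_max lexx orbT.
  have := ler_norm (- m)%R; rewrite normrN; lra.
have rx : (r < `|x|)%R by apply: le_lt_trans sx; rewrite /s le_max lexx.
have x0 : (0 < x ^+ 2)%R.
  rewrite -(real_normK (num_real x)) exprn_gt0//.
  by apply: le_lt_trans sx; rewrite /s le_max lexx orbT.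
have := hc x rx; rewrite ler_pdivlMr//; have := normr_ge0 m; lra.
Qed.

(** Since log u <= u <= (c/8) u^2 + 2/c and |x-y|^2 <= 2 (x^2 + y^2), the
    logarithm uses up only half of the quadratic growth of V. *)
Lemma log_kernel_ge (V : R -> R) (c B : R) (z : R * R) : (0 < c)%R ->
  (forall x, c * x ^+ 2 <= V x + B)%R ->
  (c / 4 * (z.1 ^+ 2 + z.2 ^+ 2))%:E <=
  log_kernel (fun x => V x / 2 + (B + 2 / c) / 2)%R z.
Proof.
move=> c0 hV; rewrite /log_kernel; move: z.1 z.2 => x y.
have := normr_ge0 (x - y)%R; rewrite le_eqVlt => /predU1P[<-|u0].
  by rewrite le0_lneNy//= leey.
rewrite lne_EFin// -EFinB lee_fin.
have := ln_sublinear u0; have := hV x; have := hV y.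
have : (`|x - y| <= c / 8 * `|x - y| ^+ 2 + 2 / c)%R.
  rewrite -subr_ge0 (_ : _ - _ = c / 8 * (`|x - y| - 4 / c) ^+ 2)%R; last by field; lra.
  by rewrite mulr_ge0 ?sqr_ge0 ?divr_ge0// ltW.
have : (`|x - y| ^+ 2 <= 2 * (x ^+ 2 + y ^+ 2))%R.
  by rewrite real_normK ?num_real//; have := sqr_ge0 (x + y)%R; nra.
set u := `|x - y|%R; set u2 := (u ^+ 2)%R; move=> h1 h2 h3 h4 h5.
have : (c / 8 * u2 <= c / 8 * (2 * (x ^+ 2 + y ^+ 2)))%R by rewrite ler_pM2l// divr_gt0.
lra.
Qed.

End growth.

(** * The transport inequality *)

Section transport_inequality.
Context (R : realType).
Notation T := (measurableTypeR R).
Implicit Types mu nu : probability T R.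

Lemma null_tail (r : R) mu : (0 < r)%R ->
  \int[mu]_(x in ~` `[(- r)%R, r]) (x ^+ 2)%:E = 0 ->
  mu (~` `[(- r)%R, r]%classic) = 0.
Proof.
move=> r0 tail0; apply/eqP; rewrite eq_le measure_ge0 andbT.
have := tail_mass_le mu (ltW r0).
by rewrite tail0 -[X in _ <= X -> _](mule0 (r ^+ 2)%:E) lee_pmul2l// lte_fin exprn_gt0.
Qed.

(** The radius r satisfies k r^2 >= 2 I(nu,nu), as [energy_tail] requires.  Adding
    [energy_gap_ge] and twice [energy_tail] eliminates I(mu,nu). *)
Lemma transport_inequality (b : R -> R) (k c : R) nu :
  measurable_fun [set: T] (b : T -> T) -> (forall x, 0 <= b x)%R ->
  (0 < k)%R -> (forall z, (k * z.1 ^+ 2)%:E <= log_kernel b z) -> (0 <= c)%R ->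
  (forall z, `|z.1 - z.2|%R%:E <= 1 + c%:E * log_kernel b z) ->
  (forall rho : probability T R,
    mutual_energy b nu nu <= mutual_energy b rho rho) ->
  mutual_energy b nu nu < +oo ->
  exists C : R, (0 < C)%R /\ forall mu : probability T R,
    C%:E * wasserstein1 mu nu ^+ 2 <= mutual_energy b mu mu - mutual_energy b nu nu.
Proof.
move=> mb b0 k0 Kk c0 Kdist minnu Inu.
have K0 z : 0 <= log_kernel b z.
  by apply: le_trans (Kk z); rewrite lee_fin mulr_ge0 ?sqr_ge0// ltW.
have I0 (m n : probability T R) : 0 <= mutual_energy b m n by apply: integral_ge0 => z _.
have Inuf : mutual_energy b nu nu \is a fin_num by rewrite ge0_fin_numE.
pose g := fine (mutual_energy b nu nu).
have g0 : (0 <= g)%R by exact: fine_ge0.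
have gE : mutual_energy b nu nu = g%:E by rewrite fineK.
pose r := (2 * g / k + 1)%R.
have r1 : (1 <= r)%R by rewrite /r lerDr divr_ge0 ?mulr_ge0// ltW.
have r0 : (0 < r)%R by apply: lt_le_trans r1.
have kr : mutual_energy b nu nu + mutual_energy b nu nu <= (k * r ^+ 2)%:E.
  rewrite gE -EFinD lee_fin.
  have : (k * r = 2 * g + k)%R by rewrite /r; field; lra.
  have : (k * r <= k * r ^+ 2)%R by rewrite ler_pM2l// expr2 ler_peMl// ltW.
  lra.
pose tail (m : probability T R) := \int[m]_(x in ~` `[(- r)%R, r]) (x ^+ 2)%:E.
have tail0 m : 0 <= tail m by apply: integral_ge0 => x _; rewrite lee_fin sqr_ge0.
have htail m : mutual_energy b m m < +oo ->
    g%:E + (k / 2)%:E * tail m <= mutual_energy b m nu.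
  by move=> Im; rewrite -gE; exact: (energy_tail mb Kk k0 minnu Im (ltW r0) kr).
have k20 : (0 < k / 2)%R by rewrite divr_gt0.
have tailnu : tail nu = 0.
  apply/eqP; rewrite eq_le tail0 andbT.
  have := htail nu Inu; rewrite gE -[leRHS]adde0 leeD2lE//.
  by rewrite -[X in _ <= X -> _](mule0 (k / 2)%:E) lee_pmul2l ?lte_fin.
have nutail := null_tail r0 tailnu.
pose D := (9 * r + (2 / r + 1) / k)%R.
have rinv : (0 <= 2 / r)%R by rewrite divr_ge0// ltW.
have D0 : (0 < D)%R by rewrite ltr_wpDr ?mulr_gt0 ?divr_ge0 ?addr_ge0// ltW.
have c'0 : (0 < 4 * r + 1)%R by lra.
pose C := (4 * (4 * r + 1) * D)%R.
have C0 : (0 < C)%R by rewrite /C !mulr_gt0.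
exists C^-1%R; split; first by rewrite invr_gt0.
move=> mu.
have [Imu|] := ltP (mutual_energy b mu mu) +oo; last first.
  by rewrite leye_eq => /eqP ->; rewrite gE addye// leey.
have Imuf : mutual_energy b mu mu \is a fin_num by rewrite ge0_fin_numE.
have := energy_gap_ge (3 * r) mb b0 K0 c0 Kdist Imu Inu.
have := htail mu Imu.
rewrite gE -(fineK Imuf) -EFinD; set i := fine (mutual_energy b mu mu).
have : 0 <= mutual_energy b mu nu by exact: I0.
have := smoothed_gap_ge0 mu nu (3 * r).
case: (mutual_energy b mu nu) => [m| |]//; case qE : (smoothed_gap mu nu (3 * r)) => [q| |]//.
rewrite !lee_fin => q0 m0 htm hgap.
have tf : tail mu \is a fin_num.
  move: htm (tail0 mu); case: (tail mu) => [//| |//].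
  by rewrite gt0_muley ?lte_fin// addey.
have tE : tail mu = (fine (tail mu))%:E by rewrite fineK.
move: htm hgap; rewrite tE -!EFinM -!EFinD !lee_fin.
set t := fine (tail mu) in tE * => htm hgap.
have t0 : (0 <= t)%R by exact: fine_ge0.
have hX (l : R) : (0 < l)%R -> wasserstein1 mu nu <=
    (l * (9 * r * q + (2 / r + 1) * t) + (4 * r + 1) / l)%:E.
  by move=> l0; exact: wasserstein1_le_smoothed_gap.
have X0 : (0 <= 9 * r * q + (2 / r + 1) * t)%R.
  apply: addr_ge0; apply: mulr_ge0 => //; first by rewrite mulr_ge0// ltW.
  by rewrite addr_ge0.
have := sqr_le_of_linear (wasserstein1_ge0 mu nu) X0 c'0 hX.
have XD : (9 * r * q + (2 / r + 1) * t <= D * (i - g))%R.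
  apply: le_trans (_ : D * (q + k * t) <= _)%R; last first.
    by rewrite ler_pM2l//; lra.
  have : (0 <= 9 * r * (k * t))%R by rewrite !mulr_ge0// ltW.
  have : (0 <= (2 / r + 1) / k * q)%R by rewrite !mulr_ge0 ?addr_ge0 ?invr_ge0// ltW.
  rewrite (_ : D * _ = 9 * r * q + 9 * r * (k * t) + (2 / r + 1) / k * q +
      (2 / r + 1) * t)%R; last first.
    by rewrite /D; field; lra.
  lra.
move=> hW; rewrite -?EFinB.
apply: le_trans (_ : C^-1%:E * (C * (i - g))%:E <= _); last first.
  by rewrite -EFinM mulKf ?gt_eqF.
apply: lee_wpmul2l; first by rewrite lee_fin invr_ge0 ltW.
apply: le_trans hW _; rewrite lee_fin /C -[leRHS]mulrA ler_pM2l//.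
by rewrite mulr_gt0.
Qed.

End transport_inequality.

Lemma dist_le_quadratic (R : realType) (c x y : R) : (0 < c)%R ->
  (`|x - y| <= 1 + 8 / c * (c / 4 * (x ^+ 2 + y ^+ 2)))%R.
Proof.
move=> c0; rewrite (_ : 8 / c * _ = 2 * (x ^+ 2 + y ^+ 2))%R; last by field; lra.
have : (`|x - y| <= 1 + `|x - y| ^+ 2)%R.
  by have := sqr_ge0 (`|x - y| - 1)%R; have := normr_ge0 (x - y)%R; nra.
rewrite real_normK ?num_real//.
have := sqr_ge0 (x + y)%R; nra.
Qed.

Section log_energy_reduction.
Context (R : realType).
Notation T := (measurableTypeR R).

Lemma log_energyE (V : R -> R) (a : R) (mu : probability T R) :
  measurable_fun [set: T] (V : T -> T) -> (0 <= a)%R ->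
  (forall z, 0 <= log_kernel (fun x => V x / 2 + a / 2)%R z) ->
  log_energy V mu = mutual_energy (fun x => V x / 2 + a / 2)%R mu mu - a%:E.
Proof.
move=> mV a0 K0; rewrite /mutual_energy.
have mb : measurable_fun [set: T] ((fun x => V x / 2 + a / 2)%R : T -> T).
  by apply: measurable_funD => //; apply: measurable_funM.
rewrite -(@ge0_integral_shift _ _ _ (product_probability mu mu))//; last first.
  exact: measurable_log_kernel.
apply: eq_integral => z _; rewrite /log_kernel addeAC; congr (_ + _).
by rewrite -EFinB; congr (_%:E); lra.
Qed.

(** If the least energy were infinite, all probability measures would be
    minimizers, in particular two distinct Dirac masses, against uniqueness. *)
Lemma equilibrium_energy_lty (V : R -> R) (muV : probability T R) :
  equilibrium_measure V muV -> log_energy V muV < +oo.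
Proof.
move=> [minV uniqV]; rewrite ltNge leye_eq; apply/negP => /eqP Eoo.
have allmin (mu : probability T R) : forall nu, log_energy V mu <= log_energy V nu.
  by move=> nu; have := minV nu; rewrite Eoo leye_eq => /eqP ->; rewrite leey.
pose d0 : probability T R := @dirac _ T (0%R : T) R.
pose d1 : probability T R := @dirac _ T (1%R : T) R.
have m0 : measurable ([set (0%R : R)] : set T) by exact: measurable_set1.
have e0 : d0 [set (0%R : R)] = 1.
  by transitivity (\d_(0%R : T) [set (0%R : R)] : \bar R) => //; rewrite diracE mem_set.
have e1 : d1 [set (0%R : R)] = 0.
  transitivity (\d_(1%R : T) [set (0%R : R)] : \bar R) => //.
  by rewrite diracE memNset//= => /eqP; rewrite oner_eq0.
have := uniqV d0 (allmin d0) _ m0; rewrite -(uniqV d1 (allmin d1) _ m0) e0 e1.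
by move=> /eqP; rewrite eqe oner_eq0.
Qed.

End log_energy_reduction.

Unset Implicit Arguments.

Theorem theorem2 (R : realType) (V : R -> R)
    (mV : measurable_fun [set: measurableTypeR R] (V : measurableTypeR R -> measurableTypeR R))
    (lbV : has_lbound (range V))
    (growthV : 0 < limf_einf (fun x : R => (V x / x ^+ 2)%R%:E) (@abs_infty R))
    (muV : probability (measurableTypeR R) R)
    (eqV : equilibrium_measure V muV) :
  exists C : R, (0 < C)%R /\
    forall mu : probability (measurableTypeR R) R,
      C%:E * wasserstein1 mu muV ^+ 2 <= relative_free_entropy V mu muV.
Proof.
have [c [B [c0 B0 hV]]] := quadratic_minorant lbV growthV.
pose a := (B + 2 / c)%R.
have a0 : (0 <= a)%R by rewrite addr_ge0// divr_ge0// ltW.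
pose b (x : R) := (V x / 2 + a / 2)%R.
have Kge (z : R * R) : (c / 4 * (z.1 ^+ 2 + z.2 ^+ 2))%:E <= log_kernel b z.
  exact: log_kernel_ge.
have c40 : (0 < c / 4)%R by rewrite divr_gt0.
have sq0 (z : R * R) : (0 <= z.1 ^+ 2 + z.2 ^+ 2)%R by rewrite addr_ge0 ?sqr_ge0.
have K0 z : 0 <= log_kernel b z.
  by apply: le_trans (Kge z); rewrite lee_fin mulr_ge0// ltW.
have EV mu := @log_energyE R V a mu mV a0 K0.
have mb : measurable_fun [set: measurableTypeR R] (b : measurableTypeR R -> measurableTypeR R).
  by apply: measurable_funD => //; apply: measurable_funM.
have b0 x : (0 <= b x)%R.
  have := hV x; have : (0 <= c * x ^+ 2)%R by rewrite mulr_ge0 ?sqr_ge0// ltW.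
  have : (0 <= 2 / c)%R by rewrite divr_ge0// ltW.
  rewrite /b /a; lra.
have Kk z : (c / 4 * z.1 ^+ 2)%:E <= log_kernel b z.
  by apply: le_trans (Kge z); rewrite lee_fin ler_pM2l// lerDl sqr_ge0.
have Kdist z : `|z.1 - z.2|%R%:E <= 1 + (8 / c)%:E * log_kernel b z.
  apply: le_trans (_ : 1 + (8 / c)%:E * (c / 4 * (z.1 ^+ 2 + z.2 ^+ 2))%:E <= _); last first.
    by apply: leeD2l; apply: lee_wpmul2l => //; rewrite lee_fin divr_ge0// ltW.
  rewrite -EFinM -EFinD lee_fin.
  exact: dist_le_quadratic.
have minV (rho : probability (measurableTypeR R) R) :
    mutual_energy b muV muV <= mutual_energy b rho rho.
  by have := eqV.1 rho; rewrite !EV leeD2rE.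
have IV : mutual_energy b muV muV < +oo.
  have := equilibrium_energy_lty eqV; rewrite EV.
  by case: (mutual_energy _ _ _) => [x| |]//; rewrite ?ltry ?ltNyr.
have c80 : (0 <= 8 / c)%R by rewrite divr_ge0// ltW.
have [C [C0 hC]] := transport_inequality mb b0 c40 Kk c80 Kdist minV IV.
exists C; split => // mu.
apply: le_trans (hC mu) _; rewrite /relative_free_entropy !EV.
have IVf : mutual_energy b muV muV \is a fin_num.
  by rewrite ge0_fin_numE//; exact: integral_ge0.
rewrite -(fineK IVf) -EFinB.
by case: (mutual_energy b mu mu) => [x| |]//; rewrite -!EFinB ?lee_fin; lra.
Qed.
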